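(* Let $V\in C^2(\mathbb{R}^d)$ be of additive form, $V(x)=\sum_{j=1}^dV_j(x_j)$, have a Lipschitz continuous gradient, and satisfy $\langle x-y,\nabla V(x)-\nabla V(y)\rangle\ge\kappa|x-y|^2$ for all $x,y\in D=[-K,K]^d$ and some $\kappa>0$. Let $(p_t)_{t\ge0}$ be the transition function of the continuous-time Markov chain on $\mathcal{K}_h$ with the transition rates $c(i,\pm_j)$ given in the context. Then for all probability measures $\nu,\eta$ on $\mathcal{K}_h$, $$\mathcal{W}_2(\nu p_t,\eta p_t)\le e^{-\kappa t}\,\mathcal{W}_2(\nu,\eta)+O(h^{1/2})\quad\text{for all }t\ge0.$$ Moreover, if $d=1$ and $p\ge2$, then $$\mathcal{W}_p(\nu p_t,\eta p_t)\le e^{-\kappa t}\,\mathcal{W}_p(\nu,\eta)+O(h^{1/p})\quad\text{for all }t\ge0.$$ Here $O(h^{1/2})$ (respectively $O(h^{1/p})$) denotes a term bounded by $Ch^{1/2}$ (respectively $Ch^{1/p}$) with a constant $C$ independent of $h$, $t$, $\nu$, $\eta$ (it may depend on $V,\sigma,K,d$ and $p$).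
   Context: Setting. Let $d\ge1$, $K>0$, $D=[-K,K]^d$, $h>0$ with $2K/h\in\mathbb{N}$, $\sigma>0$, and let $e_1,\dots,e_d$ be the standard basis of $\mathbb{R}^d$. The grid is $\mathcal{K}_h=\{i=(i_1,\dots,i_d): i_j=-K+hn_j-h/2,\ n_j\in\{1,\dots,2K/h\}\}$. Put $V^h(i)=h^{-d}\int_{[-h/2,h/2]^d}V(i+s)\,ds$. Let $G=\{+_1,-_1,\dots,+_d,-_d\}$ be the set of moves, where $\pm_j$ acts by $i\mapsto i\pm he_j$; write $\gamma i$ for the image of $i$ under $\gamma$. The transition rates are $c(i,\pm_j)=\frac{\sigma^2}{h^2}e^{-(V^h(i\pm he_j)-V^h(i))/(2\sigma^2)}$ if $i\pm he_j\in\mathcal{K}_h$ and $c(i,\pm_j)=0$ otherwise. The generator is $\mathcal{L}_hf(i)=\sum_{\gamma\in G}c(i,\gamma)(f(\gamma i)-f(i))$, and $p_t=e^{t\mathcal{L}_h}$ is the transition function of the associated continuous-time Markov chain; $\nu p_t$ is the law at time $t$ of the chain started from $\nu$. For $p\ge1$, $\mathcal{W}_p(\nu,\eta)=\inf_{\gamma\in\Gamma(\nu,\eta)}\big(\int_{\mathcal{K}_h\times\mathcal{K}_h}|x-y|^p\,\gamma(dx\,dy)\big)^{1/p}$, where $|\cdot|$ is the Euclidean norm and $\Gamma(\nu,\eta)$ is the set of probability measures on $\mathcal{K}_h\times\mathcal{K}_h$ with marginals $\nu$ and $\eta$. *)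

(* Defs.v *)
From mathcomp Require Import all_boot all_order all_algebra.
From mathcomp Require Import all_classical all_reals all_analysis.
Import Order.TTheory GRing.Theory Num.Theory.
Import numFieldNormedType.Exports.

Set Implicit Arguments.
Unset Strict Implicit.
Unset Printing Implicit Defensive.

Local Open Scope classical_set_scope.
Local Open Scope ring_scope.

(* The norm of the library on
   ['rV[R]_d] is the sup norm, so the Euclidean structure is defined here. *)

Definition dot (R : realType) (d : nat) (x y : 'rV[R]_d) : R :=
  \sum_(j < d) x 0 j * y 0 j.

Definition enorm (R : realType) (d : nat) (x : 'rV[R]_d) : R :=
  Num.sqrt (dot x x).

Definition evec (R : realType) (d : nat) (j : 'I_d) : 'rV[R]_d := delta_mx 0 j.

Definition partial (R : realType) (d : nat) (j : 'I_d) (f : 'rV[R]_d -> R)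
  (x : 'rV[R]_d) : R := 'D_(evec R j) f x.

Definition grad (R : realType) (d : nat) (f : 'rV[R]_d -> R) (x : 'rV[R]_d)
  : 'rV[R]_d := \row_(j < d) partial j f x.

Definition class_C2 (R : realType) (d : nat) (f : 'rV[R]_d -> R) : Prop :=
  [/\ continuous f,
      (forall j, (forall x, derivable f x (evec R j)) /\
                 continuous (partial j f)) &
      (forall j k, (forall x, derivable (partial j f) x (evec R k)) /\
                   continuous (partial k (partial j f)))].

Definition lipschitz_gradient (R : realType) (d : nat) (f : 'rV[R]_d -> R)
  : Prop :=
  exists L : R, forall x y, enorm (grad f x - grad f y) <= L * enorm (x - y).

Definition cube (R : realType) (d : nat) (K : R) : set 'rV[R]_d :=
  [set x | forall j, - K <= x 0 j <= K].

Definition strongly_monotone_gradient (R : realType) (d : nat) (K kappa : R)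
  (f : 'rV[R]_d -> R) : Prop :=
  forall x y, cube K x -> cube K y ->
    kappa * enorm (x - y) ^+ 2 <= dot (x - y) (grad f x - grad f y).

(* The library has no Lebesgue measure on ['rV[R]_d]. The integral over
   [a, b]^d is taken as an iterated one-dimensional Lebesgue integral, which is
   the same thing for the continuous integrands considered here. *)
Fixpoint box_integral (R : realType) (a b : R) (d : nat)
  : ('rV[R]_d -> R) -> R :=
  match d return ('rV[R]_d -> R) -> R with
  | 0 => fun f => f 0
  | d'.+1 => fun f =>
      \int[@lebesgue_measure R]_(s in `[a, b])
        box_integral a b (fun v : 'rV[R]_d' => f (row_mx (s%:M : 'rV[R]_1) v))
  end.

Definition Vavg (R : realType) (d : nat) (V : 'rV[R]_d -> R) (h : R)
  (x : 'rV[R]_d) : R :=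
  h ^- d * box_integral (- (h / 2)) (h / 2) (fun s => V (x + s)).

(* Points of the grid are represented by their indices, with N = 2K/h; the
   indices of the library start at 0, hence the successor in [gpoint]. *)
Definition grid (d N : nat) : finType := {ffun 'I_d -> 'I_N}.

Definition gpoint (R : realType) (d N : nat) (K h : R) (i : grid d N)
  : 'rV[R]_d := \row_(j < d) (- K + h * (i j).+1%:R - h / 2).

(* The move (j, true) is +_j and (j, false) is -_j. *)
Definition moves (d : nat) : finType := ('I_d * bool)%type.

Definition step (R : realType) (d : nat) (h : R) (g : moves d) : 'rV[R]_d :=
  (if g.2 then h else - h) *: evec R g.1.

(* [None] when the move leaves the grid; otherwise the target is unique, since
   [gpoint K h] is injective for h > 0. *)
Definition target (R : realType) (d N : nat) (K h : R) (i : grid d N)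
  (g : moves d) : option (grid d N) :=
  [pick k | gpoint K h k == gpoint K h i + step h g].

Definition rate (R : realType) (d N : nat) (V : 'rV[R]_d -> R) (sigma K h : R)
  (i : grid d N) (g : moves d) : R :=
  if target K h i g is Some k then
    sigma ^+ 2 / h ^+ 2 *
    expR (- (Vavg V h (gpoint K h k) - Vavg V h (gpoint K h i))
          / (2 * sigma ^+ 2))
  else 0.

(* The default value [i] only occurs where the rate is 0. *)
Definition generator (R : realType) (d N : nat) (V : 'rV[R]_d -> R)
  (sigma K h : R) (f : grid d N -> R) (i : grid d N) : R :=
  \sum_(g : moves d)
    rate V sigma K h i g * (f (odflt i (target K h i g)) - f i).

(* e^{t L} f = \sum_n t^n / n! L^n f *)
Definition semigroup (R : realType) (d N : nat) (V : 'rV[R]_d -> R)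
  (sigma K h t : R) (f : grid d N -> R) (i : grid d N) : R :=
  limn (series (fun n : nat =>
    t ^+ n / n`!%:R * iter n (generator V sigma K h) f i)).

Definition transition (R : realType) (d N : nat) (V : 'rV[R]_d -> R)
  (sigma K h t : R) (i k : grid d N) : R :=
  semigroup V sigma K h t (fun l => (l == k)%:R) i.

Definition law (R : realType) (d N : nat) (V : 'rV[R]_d -> R)
  (sigma K h t : R) (nu : grid d N -> R) (k : grid d N) : R :=
  \sum_i nu i * transition V sigma K h t i k.

(* Measures on the finite grid are given by their mass functions. *)
Definition is_prob (R : realType) (T : finType) (nu : T -> R) : Prop :=
  (forall i, 0 <= nu i) /\ \sum_i nu i = 1.

Definition couplings (R : realType) (T : finType) (nu eta : T -> R)
  : set (T * T -> R) :=
  [set g | [/\ is_prob g,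
               (forall x, \sum_y g (x, y) = nu x) &
               (forall y, \sum_x g (x, y) = eta y)]].

Definition wasserstein (R : realType) (d N : nat) (K h p : R)
  (nu eta : grid d N -> R) : R :=
  inf [set (\sum_z enorm (gpoint K h z.1 - gpoint K h z.2) `^ p * g z) `^ p^-1
      | g in couplings nu eta].

(* Main.v *)
Require Import Defs.
From mathcomp Require Import all_boot all_order all_algebra.
From mathcomp Require Import all_classical all_reals all_analysis.
From mathcomp Require Import zify ring lra.
Import Order.TTheory GRing.Theory Num.Theory.
Import numFieldNormedType.Exports.
Local Open Scope ring_scope.

(** Two copies of the chain are coupled so that they make the same move [g] at
    rate [min (c x g) (c y g)] and each makes it alone at its excess rate. By
    convexity, in every coordinate the solo moves only shrink the distance [r]
    by [h], at a total rate of at least [kappa (r / h) (1 - O(h))] (at the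
    boundary this holds once [h M <= sigma^2], [M] bounding the partial
    derivatives of [V] on the cube). Hence the coupled generator [Q] satisfies
    [Q rho <= - p kappa rho + O(h)] for [rho = \sum_j |x_j - y_j|^p], and
    Gronwall's lemma gives the claim, since [rho] is the [p]-th power of the
    Euclidean distance when [p = 2] or [d = 1]. For larger [h] the diameter of
    the cube already bounds the left-hand side. *)

(** * Exponentials of finite generators *)

(** Additivity of [V] separates the coordinates: an increment of [V^h] along [e_j] involves [Vj j]
    only, so the rate of [(j, b)] depends on the [j]-th index alone and the drift of [rho] is a sum
    of one-dimensional drifts. In each of these, [r^p - (r - h)^p >= p h (r - h)^(p - 1)] turns the
    solo rate [kappa r / h] into a loss of about [p kappa r^p]; the error comes from the factor
    [1 - O(h)] and from replacing [r - h] by [r]. The obstacle is the boundary, where a blocked copy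
    has rate 0 and convexity says nothing: there the size [sigma^2 / h^2] of the free copy's rate
    must dominate. The error carries a factor [p kappa], which cancels against the division by
    [p kappa] in Gronwall's lemma, so the final constant can be chosen before [kappa]. Taking [p]-th
    roots turns [O(h)] into [O(h^(1/p))]. *)

Definition mxop (R : realType) (S : finType) (q : S -> S -> R) (f : S -> R)
  (z : S) : R := \sum_w q z w * f w.

Definition expterm (R : realType) (S : finType) (q : S -> S -> R) (t : R)
  (f : S -> R) (z : S) (n : nat) : R :=
  t ^+ n / n`!%:R * iter n (mxop R S q) f z.

(** The series of [semigroup] for an arbitrary matrix, so that the chain and the coupled chain on
    pairs share one theory. *)
Definition expop (R : realType) (S : finType) (q : S -> S -> R) (t : R)
  (f : S -> R) (z : S) : R := limn (series (expterm R S q t f z)).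

Arguments mxop {R S}.
Arguments expterm {R S}.
Arguments expop {R S}.

Lemma mxopE (R : realType) (S : finType) (q : S -> S -> R) f z :
  mxop q f z = \sum_w q z w * f w.
Proof. by []. Qed.

(** With [C] the sum of all [|q z w|] and [B] that of all [|f w|], the [n]-th iterate is at most
    [B * C ^+ n], so an exponential series dominates. *)
Lemma is_cvg_expterm (R : realType) (S : finType) (q : S -> S -> R) t f z :
  cvgn (series (expterm q t f z)).
Proof.
pose C := \sum_z \sum_w `|q z w|; pose B := \sum_w `|f w|.
have C0 : 0 <= C by do 2 (apply: sumr_ge0 => ? _).
have B0 : 0 <= B by apply: sumr_ge0.
have bound n i : `|iter n (mxop q) f i| <= B * C ^+ n.
  elim: n i => [|n IH] i /=.
    by rewrite expr0 mulr1 /B (bigD1 i) //= lerDl sumr_ge0.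
  rewrite /mxop (le_trans (ler_norm_sum _ _ _))//.
  apply: (@le_trans _ _ (\sum_w `|q i w| * (B * C ^+ n))).
    by apply: ler_sum => w _; rewrite normrM ler_wpM2l.
  rewrite -mulr_suml exprS [leRHS]mulrCA ler_wpM2r ?mulr_ge0 ?exprn_ge0//.
  by rewrite /C [leRHS](bigD1 i) //= lerDl sumr_ge0 // => ? _; apply: sumr_ge0.
apply: normed_cvg.
apply: (@series_le_cvg _ _ (fun n => B * exp_coeff (`|t| * C) n)).
- by move=> n /=; exact: normr_ge0.
- by move=> n; rewrite mulr_ge0 // exp_coeff_ge0 // mulr_ge0.
- move=> n; rewrite /= /exp_coeff /= /expterm normrM normrM normrX normfV.
  rewrite (ger0_norm (ler0n _ _)) exprMn.
  rewrite mulrC -!mulrA; apply: le_trans (_ : B * C ^+ n * (`|t| ^+ n / n`!%:R) <= _).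
    by rewrite ler_wpM2r // mulr_ge0 ?exprn_ge0 // invr_ge0.
  by rewrite le_eqVlt; apply/orP; left; apply/eqP; ring.
- rewrite (_ : (fun n => _) = B *: exp_coeff (`|t| * C)); last by apply/funext.
  by apply: is_cvg_seriesZ; exact: is_cvg_series_exp_coeff.
Qed.

Lemma expop_cvg (R : realType) (S : finType) (q : S -> S -> R) t f z :
  (series (expterm q t f z) @ \oo --> expop q t f z)%classic.
Proof. exact: is_cvg_expterm. Qed.

Lemma iter_mxop_sum (R : realType) (S W : finType) (q : S -> S -> R)
    (a : W -> R) (g : W -> S -> R) n z :
  iter n (mxop q) (fun x => \sum_w a w * g w x) z =
  \sum_w a w * iter n (mxop q) (g w) z.
Proof.
elim: n z => [//|n IH] z /=; rewrite mxopE.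
under [LHS]eq_bigr => w _ do rewrite IH mulr_sumr.
rewrite exchange_big; apply: eq_bigr => w _ /=.
by rewrite mxopE mulr_sumr; apply: eq_bigr => v _; rewrite mulrCA.
Qed.

(** Linearity in the form of a finite family, which serves both expansions over indicators and
    explicit short combinations. *)
Lemma expop_sum (R : realType) (S W : finType) (q : S -> S -> R)
    (a : W -> R) (g : W -> S -> R) t z :
  expop q t (fun x => \sum_w a w * g w x) z = \sum_w a w * expop q t (g w) z.
Proof.
apply: cvg_lim => //.
rewrite (_ : series _ = fun n => \sum_w a w * series (expterm q t (g w) z) n).
  apply: cvg_big => [|w _]; first by move=> x; exact: add_continuous.
  by apply: cvgM; [exact: cvg_cst|exact: expop_cvg].
apply/funext => n; rewrite /series /=.
under [RHS]eq_bigr => w _ do rewrite mulr_sumr.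
rewrite exchange_big; apply: eq_bigr => k _ /=.
rewrite /expterm iter_mxop_sum mulr_sumr.
by apply: eq_bigr => w _; rewrite mulrCA.
Qed.

Lemma expop_mxopC (R : realType) (S : finType) (q : S -> S -> R) t f z :
  expop q t (mxop q f) z = mxop q (expop q t f) z.
Proof.
apply: cvg_lim => //.
rewrite (_ : series _ = fun n => \sum_w q z w * series (expterm q t f w) n).
  apply: cvg_big => [|w _]; first by move=> x; exact: add_continuous.
  by apply: cvgM; [exact: cvg_cst|exact: expop_cvg].
apply/funext => n; rewrite /series /=.
under [RHS]eq_bigr => w _ do rewrite mulr_sumr.
rewrite exchange_big; apply: eq_bigr => k _ /=.
rewrite /expterm -iterSr iterS mxopE mulr_sumr.
by apply: eq_bigr => w _; rewrite mulrCA.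
Qed.

Lemma expop0 (R : realType) (S : finType) (q : S -> S -> R) f z :
  expop q 0 f z = f z.
Proof.
(* The partial sum of length 0 is empty; from length 1 on the partial sums are constant. *)
apply: cvg_lim => //; rewrite -(cvg_shiftn 1) /=.
rewrite (_ : (fun n => _) = fun=> f z); first exact: cvg_cst.
apply/funext => n; rewrite addn1 /series /= big_nat_recl // big1 ?addr0.
  by rewrite /expterm /= expr0 fact0 divr1 mul1r.
by move=> k _; rewrite /expterm expr0n /= !mul0r.
Qed.

(** Termwise differentiation of a power series in [t]: the factor [n.+1] cancels in the factorial
    and leaves one more application of [q]. The series and its first two formal derivatives converge
    everywhere, hence also at the radius [|t| + 1]. *)
Lemma is_derive_expop (R : realType) (S : finType) (q : S -> S -> R) f z
    (t : R) :
  is_derive t 1 (fun s => expop q s f z) (expop q t (mxop q f) z).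
Proof.
pose c g n : R := n`!%:R^-1 * iter n (mxop q) g z.
have cE g s : pseries (c g) s = series (expterm q s g z).
  congr series; apply/funext => n; rewrite /c /expterm /=; ring.
have dE g : pseries_diffs (c g) = c (mxop q g).
  apply/funext => n; rewrite /pseries_diffs /c iterSr factS natrM invfM mulrA.
  by rewrite mulVKf // mulrA.
have -> : (fun s => expop q s f z) = fun s => limn (pseries (c f) s).
  by apply/funext => s; rewrite cE.
have -> : expop q t (mxop q f) z = limn (pseries (pseries_diffs (c f)) t).
  by rewrite dE cE.
apply: (@pseries_snd_diffs _ _ (`|t| + 1)).
- by rewrite cE; exact: is_cvg_expterm.
- by rewrite dE cE; exact: is_cvg_expterm.
- by rewrite !dE cE; exact: is_cvg_expterm.
- by rewrite (ger0_norm (addr_ge0 _ _)) ?normr_ge0 // ltrDl.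
Qed.

Lemma sum_indicator (R : realType) (S : finType) (f : S -> R) :
  (fun x => \sum_w f w * (x == w)%:R) = f.
Proof.
apply/funext => x; rewrite (bigD1 x) //= eqxx mulr1 big1 ?addr0 // => w.
by rewrite eq_sym => /negPf ->; rewrite mulr0.
Qed.

Lemma is_derive_sumT (R : realType) (W : finType) (F : W -> R -> R)
    (dF : W -> R) (x : R) :
  (forall w, is_derive x 1 (F w) (dF w)) ->
  is_derive x 1 (fun s => \sum_w F w s) (\sum_w dF w).
Proof.
move=> dFw; elim: (index_enum W) => [|w r IH].
  rewrite big_nil (_ : (fun s => _) = cst 0); first exact: is_derive_cst.
  by apply/funext => s; rewrite big_nil.
rewrite big_cons (_ : (fun s => _) = F w + fun s => \sum_(w <- r) F w s).
  exact: is_deriveD.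
by apply/funext => s; rewrite big_cons.
Qed.

Lemma is_derive_expop_rev (R : realType) (S : finType) (q : S -> S -> R) f z
    (t s : R) :
  is_derive s 1 (fun s => expop q (t - s) f z)
    (- expop q (t - s) (mxop q f) z).
Proof.
have H : is_derive s 1 (fun s : R => t - s) (-1).
  rewrite -[X in is_derive _ _ _ X]sub0r.
  exact: (is_deriveB (is_derive_cst t s 1) (is_derive_id s 1)).
have := @is_derive1_comp _ (fun s => expop q s f z) (fun s => t - s) s _ _
  (is_derive_expop _ _ _ _ _ _) H.
by rewrite mulrN1.
Qed.

(* [s |-> expop q (t - s) (v s)] is constant. *)
Lemma expop_unique (R : realType) (S : finType) (q : S -> S -> R)
    (v : R -> S -> R) :
  (forall (s : R) z, is_derive s 1 (v ^~ z) (mxop q (v s) z)) ->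
  forall t z, v t z = expop q t (v 0) z.
Proof.
move=> dv t z.
(* Expanding [v s] over indicators separates the two dependences on [s], so that each summand is a
   product of two real functions. *)
pose D s := \sum_w v s w * expop q (t - s) (fun x => (x == w)%:R) z.
have DE s : D s = expop q (t - s) (v s) z
  by rewrite /D -(expop_sum _ _ _ q _ (fun w x => (x == w)%:R)) sum_indicator.
suff : D t = D 0 by rewrite !DE subrr subr0 expop0.
apply: is_derive_0_is_cst => s.
have -> : 0 = \sum_w (v s w * - expop q (t - s) (mxop q (fun x => (x == w)%:R)) z
   + expop q (t - s) (fun x => (x == w)%:R) z * mxop q (v s) w).
  rewrite big_split /=.
  under eq_bigr do rewrite mulrN.
  under [X in _ + X]eq_bigr do rewrite mulrC.
  rewrite sumrN -(expop_sum _ _ _ q _ (fun w x => (x == w)%:R)).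
  rewrite -(expop_sum _ _ _ q _ (fun w => mxop q (fun x => (x == w)%:R))).
  rewrite sum_indicator.
  have -> : (fun x => \sum_w v s w * mxop q (fun y => (y == w)%:R) x)
      = mxop q (v s).
    apply/funext => x; rewrite -[in RHS](sum_indicator _ _ (v s)).
    by rewrite -(iter_mxop_sum _ _ _ _ _ _ 1).
  by rewrite addNr.
apply: is_derive_sumT => w.
apply: is_deriveM.
exact: is_derive_expop_rev.
Qed.

Lemma is_derive_expRM (R : realType) (c s : R) :
  is_derive s 1 (fun s => expR (c * s)) (expR (c * s) * c).
Proof.
apply: (@is_derive1_comp _ expR ( *%R c)).
apply: is_derive_eq (is_deriveZ c (is_derive_id s 1)) _.
by rewrite /GRing.scale /= mulr1.
Qed.

Lemma expop_ge0 (R : realType) (S : finType) (q : S -> S -> R) t f z :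
  (forall x y, x != y -> 0 <= q x y) -> 0 <= t -> (forall x, 0 <= f x) ->
  0 <= expop q t f z.
Proof.
move=> q0 t0 f0.
(* Uniformization: [q + l I] has nonnegative entries and
   [e^(t q) = e^(- l t) e^(t (q + l I))]. *)
pose l := \sum_x `|q x x|.
pose a x y := q x y + l * (y == x)%:R.
have a0 x y : 0 <= a x y.
  rewrite /a; case: eqVneq => [->|yx]; last by rewrite mulr0 addr0 q0 // eq_sym.
  rewrite mulr1 /l (bigD1 x) //= addrA addr_ge0 ?sumr_ge0 //.
  by rewrite -lerBlDl sub0r -normrN ler_norm.
have aE g x : mxop a g x = mxop q g x + l * g x.
  rewrite !mxopE /a; under eq_bigr do rewrite mulrDl.
  rewrite big_split /=; congr (_ + _).
  rewrite (bigD1 x) //= eqxx mulr1 big1 ?addr0 // => y /negPf ->.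
  by rewrite mulr0 mul0r.
pose v s x := expR (- l * s) * expop a s f x.
have -> : expop q t f = expop q t (v 0).
  by congr expop; apply/funext => x; rewrite /v mulr0 expR0 mul1r expop0.
suff <- : v t z = expop q t (v 0) z.
  rewrite mulr_ge0 ?expR_ge0 //.
  have itge0 n x : 0 <= iter n (mxop a) f x.
    elim: n x => //= n IH x; rewrite mxopE sumr_ge0 // => y _; exact: mulr_ge0.
  apply: limr_ge; first exact: is_cvg_expterm.
  near=> n; apply: sumr_ge0 => k _; rewrite /expterm.
  by rewrite !mulr_ge0 // ?invr_ge0 // exprn_ge0.
apply: expop_unique => s x; rewrite /v.
apply: is_derive_eq
  (is_deriveM (is_derive_expRM _ (- l) s) (is_derive_expop _ _ a f x s)) _.
rewrite expop_mxopC aE mxopE.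
rewrite /GRing.scale /= mulrDr mulr_sumr [in RHS]mxopE.
under [RHS]eq_bigr do rewrite mulrCA.
rewrite -!addrA -[RHS]addr0; congr (_ + _); ring.
Unshelve. all: by end_near.
Qed.

Lemma expop_cst (R : realType) (S : finType) (q : S -> S -> R) t c z :
  (forall x, \sum_y q x y = 0) -> expop q t (fun=> c) z = c.
Proof.
move=> q0; symmetry; apply: (expop_unique _ _ q (fun _ _ => c)) => s x.
rewrite mxopE -mulr_suml q0 mul0r; exact: is_derive_cst.
Qed.

(** Both sides solve the linear equation of [q'] with the same initial value. Applied to the two
    projections, this shows that each copy in the coupling evolves like the original chain. *)
Lemma expop_intertwine (R : realType) (S S' : finType) (q : S -> S -> R)
    (q' : S' -> S' -> R) (pr : S' -> S) t f z :
  (forall g x, mxop q' (g \o pr) x = mxop q g (pr x)) ->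
  expop q' t (f \o pr) z = expop q t f (pr z).
Proof.
move=> qq'; symmetry.
have -> : f \o pr = fun x => expop q 0 f (pr x).
  by apply/funext => x; rewrite expop0.
apply: (expop_unique _ _ q' (fun t z => expop q t f (pr z))) => s x.
rewrite (qq' (expop q s f)) -expop_mxopC; exact: is_derive_expop.
Qed.

(** The function [e^(c s) (expop q s f z - b / c)] has derivative [e^(c s)] times [expop q s] of
    [mxop q f + c f - b], which is nonpositive because the semigroup preserves positivity and fixes
    constants. *)
Lemma expop_gronwall (R : realType) (S : finType) (q : S -> S -> R) t f z
    (c b : R) :
  (forall x y, x != y -> 0 <= q x y) -> (forall x, \sum_y q x y = 0) ->
  0 <= t -> 0 < c -> 0 <= b -> (forall x, mxop q f x <= - c * f x + b) ->
  expop q t f z <= expR (- c * t) * f z + b / c.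
Proof.
move=> q0 q1 t0 c0 b0 qf.
pose phi s := expR (c * s) * (expop q s f z - b / c).
pose dphi s := expR (c * s) * (expop q s (mxop q f) z + c * expop q s f z - b).
have dE (s : R) : is_derive s 1 phi (dphi s).
  apply: is_derive_eq (is_deriveM (is_derive_expRM _ c s)
    (is_deriveB (is_derive_expop _ _ q f z s) (is_derive_cst (b / c) s 1))) _.
  rewrite /dphi /GRing.scale /= /cst !fctE subr0; field; exact: lt0r_neq0.
have dphi0 s : 0 <= s -> dphi s <= 0.
  move=> s0; rewrite mulr_ge0_le0 ?expR_ge0 //.
  pose g x := b + (- c) * f x - mxop q f x.
  have : 0 <= expop q s g z.
    by apply: expop_ge0 => // x; rewrite subr_ge0 addrC qf.
  (* Writing [g] as a combination of three functions brings it into the form that [expop_sum]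
     handles. *)
  have -> : g = fun x => \sum_(i < 3) [:: 1; - c; - 1]`_i *
      nth (fun=> 0) [:: fun=> b; f; mxop q f] i x.
    by apply/funext => x; rewrite !big_ord_recl big_ord0 /= mul1r mulN1r addr0 addrA.
  rewrite expop_sum !big_ord_recl big_ord0 /= expop_cst //; lra.
have [|s /itvP s0t dif] := @MVT_segment R phi dphi 0 t t0 (fun x _ => dE x).
  apply: continuous_subspaceT => s.
  by apply/differentiable_continuous/derivable1_diffP; case: (dE s).
have : phi t - phi 0 <= 0.
  by rewrite dif mulr_le0_ge0 ?dphi0 ?subr_ge0 // s0t.
rewrite /phi mulr0 expR0 mul1r expop0 => H.
have bc0 : 0 <= b / c by rewrite divr_ge0 // ltW.
rewrite -lerBlDr -(ler_pM2l (expR_gt0 (c * t))) mulrA -expRD mulNr addrN expR0.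
by rewrite mul1r; lra.
Qed.

(** * Coupled jump processes *)

(** The second indicator puts the total exit rate on the diagonal. A move that fixes [z] cancels, so
    default targets contribute nothing. *)
Definition jumpmx (R : realType) (S M : finType) (c : S -> M -> R)
    (tau : S -> M -> S) (z w : S) : R :=
  \sum_m c z m * ((w == tau z m)%:R - (w == z)%:R).

Arguments jumpmx {R S M}.

Lemma mxop_jumpmx (R : realType) (S M : finType) (c : S -> M -> R)
    (tau : S -> M -> S) f z :
  mxop (jumpmx c tau) f z = \sum_m c z m * (f (tau z m) - f z).
Proof.
rewrite mxopE /jumpmx; under eq_bigr do rewrite mulr_suml.
rewrite exchange_big; apply: eq_bigr => m _ /=.
have E x : \sum_w (w == x)%:R * f w = f x.
  rewrite (bigD1 x) //= eqxx mul1r big1 ?addr0 // => w /negPf ->.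
  by rewrite mul0r.
under eq_bigr do rewrite -mulrA.
rewrite -mulr_sumr -!E -sumrB; congr (_ * _).
by apply: eq_bigr => w _; rewrite mulrBl.
Qed.

Lemma jumpmx_ge0 (R : realType) (S M : finType) (c : S -> M -> R)
    (tau : S -> M -> S) x y :
  (forall z m, 0 <= c z m) -> x != y -> 0 <= jumpmx c tau x y.
Proof.
move=> c0 xy; apply: sumr_ge0 => m _.
by rewrite [y == x]eq_sym (negPf xy) subr0 mulr_ge0.
Qed.

Lemma sum_jumpmx (R : realType) (S M : finType) (c : S -> M -> R)
    (tau : S -> M -> S) x : \sum_y jumpmx c tau x y = 0.
Proof.
under eq_bigr do rewrite -[jumpmx _ _ _ _]mulr1.
by rewrite -mxopE mxop_jumpmx big1 // => m _; rewrite subrr mulr0.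
Qed.

(** The three summands of [M + M + M] are the joint moves, the solo moves of the first copy and
    those of the second. *)
Definition coupled_rate (R : realType) (S M : finType) (c : S -> M -> R)
    (z : S * S) (m : (M + M + M)%type) : R :=
  match m with
  | inl (inl m) => Num.min (c z.1 m) (c z.2 m)
  | inl (inr m) => c z.1 m - Num.min (c z.1 m) (c z.2 m)
  | inr m => c z.2 m - Num.min (c z.1 m) (c z.2 m)
  end.

Definition coupled_move (S M : finType) (tau : S -> M -> S)
    (z : S * S) (m : (M + M + M)%type) : S * S :=
  match m with
  | inl (inl m) => (tau z.1 m, tau z.2 m)
  | inl (inr m) => (tau z.1 m, z.2)
  | inr m => (z.1, tau z.2 m)
  end.

Definition coupledmx (R : realType) (S M : finType) (c : S -> M -> R)
    (tau : S -> M -> S) : S * S -> S * S -> R :=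
  jumpmx (coupled_rate R S M c) (coupled_move S M tau).

Arguments coupledmx {R S M}.

Lemma mxop_coupledmx (R : realType) (S M : finType) (c : S -> M -> R)
    (tau : S -> M -> S) (f : S * S -> R) x y :
  mxop (coupledmx c tau) f (x, y) =
  \sum_m (Num.min (c x m) (c y m) * (f (tau x m, tau y m) - f (x, y))
    + (c x m - Num.min (c x m) (c y m)) * (f (tau x m, y) - f (x, y))
    + (c y m - Num.min (c x m) (c y m)) * (f (x, tau y m) - f (x, y))).
Proof. by rewrite mxop_jumpmx !big_sumType /= !big_split. Qed.

(** The joint rate and the excess rate of the first copy add up to [c z.1 m], and solo moves of the
    second copy do not change [g \o fst]. *)
Lemma coupledmx_fst (R : realType) (S M : finType) (c : S -> M -> R)
    (tau : S -> M -> S) g z :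
  mxop (coupledmx c tau) (g \o fst) z = mxop (jumpmx c tau) g z.1.
Proof.
case: z => x y; rewrite mxop_coupledmx mxop_jumpmx /=.
by apply: eq_bigr => m _; ring.
Qed.

Lemma coupledmx_snd (R : realType) (S M : finType) (c : S -> M -> R)
    (tau : S -> M -> S) g z :
  mxop (coupledmx c tau) (g \o snd) z = mxop (jumpmx c tau) g z.2.
Proof.
case: z => x y; rewrite mxop_coupledmx mxop_jumpmx /=.
by apply: eq_bigr => m _; ring.
Qed.

Lemma coupled_rate_ge0 (R : realType) (S M : finType) (c : S -> M -> R) :
  (forall z m, 0 <= c z m) -> forall z m, 0 <= coupled_rate R S M c z m.
Proof.
move=> c0 [x y] [[m|m]|m] /=; first by rewrite le_min !c0.
all: by rewrite subr_ge0 ge_min lexx ?orbT.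
Qed.

Definition flow (R : realType) (S : finType) (q : S -> S -> R) (t : R)
  (nu : S -> R) (k : S) : R := \sum_i nu i * expop q t (fun l => (l == k)%:R) i.

Arguments flow {R S}.

(** Duality: expanding [f] over indicators moves the evolution from the mass function to the
    observable, where drift bounds apply. *)
Lemma sum_flow (R : realType) (S : finType) (q : S -> S -> R) t nu f :
  \sum_k f k * flow q t nu k = \sum_i nu i * expop q t f i.
Proof.
rewrite /flow; under eq_bigr do rewrite mulr_sumr.
rewrite exchange_big; apply: eq_bigr => i _ /=.
under eq_bigr do rewrite mulrCA.
by rewrite -mulr_sumr -[in RHS](sum_indicator _ _ f) expop_sum.
Qed.

Lemma sum_pairE (R : realType) (S T : finType) (F : S * T -> R) :
  \sum_z F z = \sum_a \sum_b F (a, b).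
Proof. by rewrite pair_bigA; apply: eq_bigr => -[]. Qed.

(** The total mass is kept because constants are invariant. A marginal is the integral of an
    indicator composed with a projection, and intertwining reduces it to the single chain. *)
Lemma flow_coupling (R : realType) (S M : finType) (c : S -> M -> R)
    (tau : S -> M -> S) t nu eta g :
  (forall z m, 0 <= c z m) -> 0 <= t ->
  couplings nu eta g ->
  couplings (flow (jumpmx c tau) t nu) (flow (jumpmx c tau) t eta)
    (flow (coupledmx c tau) t g).
Proof.
move=> c0 t0 [[g0 g1] gl gr].
have Q0 x y : x != y -> 0 <= coupledmx c tau x y.
  by apply: jumpmx_ge0; exact: coupled_rate_ge0.
split.
- split.
    move=> z; apply: sumr_ge0 => w _; rewrite mulr_ge0 //.
    by apply: expop_ge0 => // x; rewrite ler0n.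
  under eq_bigr do rewrite -[flow _ _ _ _]mul1r.
  rewrite (sum_flow _ _ _ _ _ (fun=> 1)) -[RHS]g1.
  by apply: eq_bigr => w _; rewrite expop_cst ?mulr1 // => x; exact: sum_jumpmx.
- move=> x.
  transitivity (\sum_z (z.1 == x)%:R * flow (coupledmx c tau) t g z).
    rewrite sum_pairE /=.
    rewrite [RHS](bigD1 x) //= [X in _ + X]big1 ?addr0.
      by apply: eq_bigr => y _; rewrite eqxx mul1r.
    by move=> a /negPf ->; rewrite big1 // => y _; rewrite mul0r.
  rewrite sum_flow /flow.
  transitivity (\sum_z g z * expop (jumpmx c tau) t (fun l => (l == x)%:R) z.1).
    apply: eq_bigr => z _; congr (_ * _).
    exact: (expop_intertwine _ _ _ _ _ fst t (fun l => (l == x)%:R) z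
             (coupledmx_fst _ _ _ c tau)).
  rewrite sum_pairE /=.
  by apply: eq_bigr => a _; rewrite -mulr_suml gl.
- move=> y.
  transitivity (\sum_z (z.2 == y)%:R * flow (coupledmx c tau) t g z).
    rewrite sum_pairE /=.
    apply: eq_bigr => a _; rewrite [RHS](bigD1 y) //= eqxx mul1r big1 ?addr0 //.
    by move=> b /negPf ->; rewrite mul0r.
  rewrite sum_flow /flow.
  transitivity (\sum_z g z * expop (jumpmx c tau) t (fun l => (l == y)%:R) z.2).
    apply: eq_bigr => z _; congr (_ * _).
    exact: (expop_intertwine _ _ _ _ _ snd t (fun l => (l == y)%:R) z
             (coupledmx_snd _ _ _ c tau)).
  rewrite sum_pairE exchange_big /=.
  by apply: eq_bigr => b _; rewrite -mulr_suml gr.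
Qed.

Lemma flow_gronwall (R : realType) (S M : finType) (c : S -> M -> R)
    (tau : S -> M -> S) t g (rho : S -> R) (k b : R) :
  (forall z m, 0 <= c z m) -> 0 <= t -> 0 < k -> 0 <= b -> is_prob g ->
  (forall z, mxop (jumpmx c tau) rho z <= - k * rho z + b) ->
  \sum_z rho z * flow (jumpmx c tau) t g z <=
  expR (- k * t) * (\sum_z rho z * g z) + b / k.
Proof.
move=> c0 t0 k0 b0 [g0 g1] Qrho; rewrite sum_flow.
rewrite -[b / k]mul1r -g1 mulr_suml mulr_sumr -big_split /=.
apply: ler_sum => z _.
have -> : expR (- k * t) * (rho z * g z) + g z * (b / k) =
    g z * (expR (- k * t) * rho z + b / k) by ring.
apply: ler_wpM2l => //.
apply: expop_gronwall => // [x y xy|x]; first exact: jumpmx_ge0.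
exact: sum_jumpmx.
Qed.

(** * One-dimensional drift *)

Lemma powR_tangent (R : realType) (p a b : R) : 1 < p -> 0 <= a -> 0 <= b ->
  p * (b - a) * a `^ (p - 1) <= b `^ p - a `^ p.
Proof.
move=> p1 a0 b0; have p0 : 0 < p by lra.
have q0 : 0 < p - 1 by lra.
(* Young's inequality for [b] and [a ^ (p - 1)] *)
have := @conjugate_powR _ b (a `^ (p - 1)) p (p / (p - 1)) b0 (powR_ge0 _ _) p0
  (divr_gt0 p0 q0).
rewrite -powRrM [(p - 1) * _]mulrC divfK ?lt0r_neq0 // => H.
have := H ltac:(by field; rewrite !lt0r_neq0).
rewrite -(ler_pM2l p0) => {}H.
have <- : p * (b * a `^ (p - 1)) - p * a `^ p = p * (b - a) * a `^ (p - 1).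
  by rewrite -(mulr_powRB1 a0 p0); ring.
have E : p * (b `^ p / p + a `^ p / (p / (p - 1))) = b `^ p + (p - 1) * a `^ p.
  by field; rewrite !lt0r_neq0.
by rewrite E in H; lra.
Qed.

Lemma expR_sub_ge (R : realType) (a b : R) : expR b * (a - b) <= expR a - expR b.
Proof.
have -> : expR a = expR (a - b) * expR b by rewrite -expRD subrK.
have := ler_wpM2l (expR_ge0 b) (expR_ge1Dx (a - b)); lra.
Qed.

(* Here and below [s] stands for [sigma ^+ 2]. *)
Definition up_rate (R : realType) (s h : R) (N : nat) (U : nat -> R) (n : nat) : R :=
  if (n.+1 < N)%N then s / h ^+ 2 * expR (- (U n.+1 - U n) / (2 * s)) else 0.

Definition down_rate (R : realType) (s h : R) (U : nat -> R) (n : nat) : R :=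
  if (0 < n)%N then s / h ^+ 2 * expR (- (U n.-1 - U n) / (2 * s)) else 0.

Arguments up_rate {R}.
Arguments down_rate {R}.

(** In the interior, the tangent line of [expR] bounds the difference of rates below by [s / h ^+ 2]
    times [e^(- A / (2 s)) (A - A') / (2 s)], where [A - A' >= kappa h^2 (n - m)] and the
    exponential is at least [1 - M h / (2 s)]. This is half of the required rate; the downward moves
    supply the other half. *)
Lemma up_rate_drift (R : realType) (s h K kappa M : R) (N : nat) (U : nat -> R) :
  0 < s -> 0 < h -> 0 < kappa -> h * N%:R = 2 * K -> kappa * K <= M ->
  h * M <= s ->
  (forall m n, (m <= n)%N -> (n.+1 < N)%N ->
     kappa * h * (h * (n%:R - m%:R)) <= (U n.+1 - U n) - (U m.+1 - U m)) ->
  (forall n, (n.+1 < N)%N -> `|U n.+1 - U n| <= M * h) ->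
  forall m n, (m < n < N)%N ->
  kappa * (n%:R - m%:R) * (1 - M / (2 * s) * h) / 2 <=
  up_rate s h N U m - up_rate s h N U n.
Proof.
move=> s0 h0 k0 hN kK hM Umono Ubd m n /andP[mn nN].
have th0 : 0 <= 1 - M / (2 * s) * h.
  have : M / (2 * s) * h <= 1 / 2.
    have -> : M / (2 * s) * h = (h * M) / (2 * s) by field; rewrite lt0r_neq0.
    by rewrite ler_pdivrMr; lra.
  by lra.
have sh0 : 0 < s / h ^+ 2 by rewrite divr_gt0 // exprn_gt0.
have eb k : (k.+1 < N)%N ->
    1 - M / (2 * s) * h <= expR (- (U k.+1 - U k) / (2 * s)).
  move=> /Ubd; rewrite ler_norml => /andP[_ Uk].
  apply: le_trans (expR_ge1Dx _); rewrite lerD2l mulNr lerN2.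
  by rewrite mulrAC ler_pM2r // invr_gt0; lra.
have mN : (m.+1 < N)%N by exact: leq_ltn_trans nN.
rewrite /up_rate mN; case: ifPn => nN'; last first.
  (* Boundary case: the upper copy is blocked. Since [h (n - m) <= 2 K] and [kappa K <= M], one has
     [kappa (n - m) h^2 / 2 <= h M <= s], so the free rate of the lower copy suffices. *)
  rewrite subr0.
  apply: le_trans (ler_wpM2l (ltW sh0) (eb _ mN)).
  rewrite mulrAC ler_wpM2r //.
  rewrite -mulrA ler_pdivlMr ?exprn_gt0 //.
  have nm : n%:R - m%:R <= N%:R :> R.
    by rewrite lerBlDr -natrD ler_nat ltnW // ltn_addr.
  have : h * (n%:R - m%:R) <= 2 * K by rewrite -hN ler_pM2l.
  move=> H; have -> : kappa * ((n%:R - m%:R) / 2) * h ^+ 2 =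
    h * (kappa * (h * (n%:R - m%:R))) / 2 by field.
  have : kappa * (h * (n%:R - m%:R)) <= 2 * M.
    by apply: le_trans (_ : kappa * (2 * K) <= _); [rewrite ler_pM2l|lra].
  by nra.
rewrite -mulrBr.
apply: le_trans (ler_wpM2l (ltW sh0) (expR_sub_ge _ _ _)).
have := Umono m n (ltnW mn) nN'.
set A := U n.+1 - U n; set A' := U m.+1 - U m => AA'.
have -> : - A' / (2 * s) - - A / (2 * s) = (A - A') / (2 * s) by ring.
have e1 := eb n nN'; rewrite -/A in e1.
apply: (@le_trans _ _ (s / h ^+ 2 * ((1 - M / (2 * s) * h) *
    (kappa * h * (h * (n%:R - m%:R)) / (2 * s))))).
  rewrite le_eqVlt; apply/orP; left; apply/eqP; field.
  by rewrite !lt0r_neq0.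
rewrite ler_pM2l // ler_pM //.
  have nm : 0 <= n%:R - m%:R :> R by rewrite subr_ge0 ler_nat ltnW.
  by apply: divr_ge0; [rewrite !mulr_ge0 // ltW|rewrite mulr_ge0 // ltW].
by rewrite ler_pM2r // invr_gt0; lra.
Qed.

Lemma down_rate_drift (R : realType) (s h K kappa M : R) (N : nat) (U : nat -> R) :
  0 < s -> 0 < h -> 0 < kappa -> h * N%:R = 2 * K -> kappa * K <= M ->
  h * M <= s ->
  (forall m n, (m <= n)%N -> (n.+1 < N)%N ->
     kappa * h * (h * (n%:R - m%:R)) <= (U n.+1 - U n) - (U m.+1 - U m)) ->
  (forall n, (n.+1 < N)%N -> `|U n.+1 - U n| <= M * h) ->
  forall m n, (m < n < N)%N ->
  kappa * (n%:R - m%:R) * (1 - M / (2 * s) * h) / 2 <=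
  down_rate s h U n - down_rate s h U m.
Proof.
move=> s0 h0 k0 hN kK hM Umono Ubd m n /andP[mn nN].
have n0 : (0 < n)%N by exact: leq_ltn_trans mn.
have mN : (m < N)%N by exact: ltn_trans nN.
(* The reflection [k |-> N - 1 - k] exchanges the two rates. *)
pose U' k := U (N - k.+1)%N.
have dE k : (k < N)%N -> down_rate s h U k = up_rate s h N U' (N - k.+1).
  move=> kN; rewrite /down_rate /up_rate /U'.
  have -> : (N - (N - k.+1).+1 = k)%N by lia.
  have -> : ((N - k.+1).+1 < N)%N = (0 < k)%N by lia.
  case: ifP => // k0'.
  by have -> : (N - (N - k.+1).+2 = k.-1)%N by lia.
rewrite !dE //.
have eN k : (k < N)%N -> (N - k.+1)%:R = N%:R - k%:R - 1 :> R.
  by move=> kN; rewrite natrB // -natr1; lra.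
have -> : n%:R - m%:R = (N - m.+1)%:R - (N - n.+1)%:R :> R.
  by rewrite !eN //; lra.
apply: (@up_rate_drift _ _ _ K) => //; last by lia.
(* Reflection negates the increments and also reverses the order of the indices, so their
   monotonicity is preserved. *)
- move=> i k ik kN; rewrite /U'.
  have := Umono (N - k.+2)%N (N - i.+2)%N ltac:(lia) ltac:(lia).
  have -> : ((N - i.+2).+1 = N - i.+1)%N by lia.
  have -> : ((N - k.+2).+1 = N - k.+1)%N by lia.
  have -> : (N - i.+2)%:R - (N - k.+2)%:R = k%:R - i%:R :> R.
    by rewrite !eN; [rewrite -!natr1; lra|lia|lia].
  by lra.
- move=> k kN; rewrite /U' distrC.
  have := Ubd (N - k.+2)%N ltac:(lia).
  by have -> : ((N - k.+2).+1 = N - k.+1)%N by lia.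
Qed.

(** The first two bounds say that only the lower copy has an excess upward rate and only the upper
    copy an excess downward rate, so every solo move brings the copies closer by [h]. In the
    constant, the first term pays for replacing [r - h] by [r], the second for the factor
    [1 - M h / (2 s)]. *)
Lemma rates_contract (R : realType) (s h K kappa M p : R) (N : nat) (U : nat -> R) :
  0 < s -> 0 < h -> 0 < kappa -> h * N%:R = 2 * K -> kappa * K <= M ->
  h * M <= s -> 1 < p ->
  (forall m n, (m <= n)%N -> (n.+1 < N)%N ->
     kappa * h * (h * (n%:R - m%:R)) <= (U n.+1 - U n) - (U m.+1 - U m)) ->
  (forall n, (n.+1 < N)%N -> `|U n.+1 - U n| <= M * h) ->
  forall m n, (m < n < N)%N ->
  let r := h * (n%:R - m%:R) in
  [/\ up_rate s h N U n <= up_rate s h N U m,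
      down_rate s h U m <= down_rate s h U n &
      (up_rate s h N U m - up_rate s h N U n
       + (down_rate s h U n - down_rate s h U m)) * ((r - h) `^ p - r `^ p) <=
      - (p * kappa) * r `^ p +
      p * kappa * (p * (2 * K) `^ (p - 1) + M / (2 * s) * (2 * K) `^ p) * h].
Proof.
move=> s0 h0 k0 hN kK hM p1 Umono Ubd m n mnN r.
have Hu := @up_rate_drift _ _ _ K _ _ _ _ s0 h0 k0 hN kK hM Umono Ubd _ _ mnN.
have Hd := @down_rate_drift _ _ _ K _ _ _ _ s0 h0 k0 hN kK hM Umono Ubd _ _ mnN.
move: Hu Hd; set bu := _ - up_rate _ _ _ _ _; set bd := _ - down_rate _ _ _ _.
set th := 1 - _ => Hu Hd.
have /andP[mn nN] := mnN.
have nm1 : 1 <= n%:R - m%:R :> R by rewrite lerBrDr nat1r ler_nat.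
have th0 : 0 <= th.
  rewrite /th; have : M / (2 * s) * h <= 1 / 2.
    have -> : M / (2 * s) * h = (h * M) / (2 * s) by field; rewrite lt0r_neq0.
    by rewrite ler_pdivrMr; lra.
  by lra.
have low0 : 0 <= kappa * (n%:R - m%:R) * th / 2.
  by rewrite divr_ge0 // !mulr_ge0 //; lra.
split; [by rewrite -subr_ge0 -/bu; lra|by rewrite -subr_ge0 -/bd; lra|].
have p0 : 0 < p by lra.
have rh : h <= r by rewrite /r ler_peMr //; lra.
have r2K : r <= 2 * K.
  rewrite -hN /r ler_pM2l //.
  by rewrite lerBlDr -natrD ler_nat ltnW // ltn_addr.
have K0 : 0 <= K by lra.
have rh0 : 0 <= r - h by lra.
have M0 : 0 <= M by apply: le_trans kK; rewrite mulr_ge0 // ltW.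
(* The tangent at [r - h] bounds the gain of a jump from below; the tangent at [r] controls the
   later return from [(r - h)^p] to [r^p]. *)
have T1 := @powR_tangent _ p (r - h) r p1 rh0 ltac:(lra).
have T2 := @powR_tangent _ p r (r - h) p1 ltac:(lra) rh0.
have P1 : r `^ (p - 1) <= (2 * K) `^ (p - 1).
  by apply: ge0_ler_powR => //; rewrite ?nnegrE; lra.
have P2 : (r - h) `^ p <= (2 * K) `^ p.
  by apply: ge0_ler_powR => //; rewrite ?nnegrE; lra.
have beta : kappa * (n%:R - m%:R) * th <= bu + bd by lra.
have drop : (bu + bd) * ((r - h) `^ p - r `^ p) <=
    - (kappa * (n%:R - m%:R) * th * (p * h * (r - h) `^ (p - 1))).
  rewrite -lerN2 opprK -mulrN opprB ler_pM //.
  - by rewrite !mulr_ge0 //; lra.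
  - by rewrite mulr_ge0 ?powR_ge0 // mulr_ge0 // ltW.
  - by apply: le_trans T1; rewrite subKr.
apply: le_trans drop _.
(* The factor [h (n - m) = r] of the rate, being at least [r - h], restores the missing power of
   [r - h]. *)
have step1 : kappa * p * th * (r - h) `^ p <=
    kappa * (n%:R - m%:R) * th * (p * h * (r - h) `^ (p - 1)).
  have -> : kappa * (n%:R - m%:R) * th * (p * h * (r - h) `^ (p - 1)) =
    kappa * p * th * (r * (r - h) `^ (p - 1)) by rewrite /r; ring.
  rewrite -(mulr_powRB1 rh0 p0) ler_wpM2l //.
    by rewrite !mulr_ge0 // ltW.
  by rewrite ler_wpM2r ?powR_ge0 //; lra.
have step2 : r `^ p - p * h * (2 * K) `^ (p - 1) <= (r - h) `^ p.
  have : p * h * r `^ (p - 1) <= p * h * (2 * K) `^ (p - 1).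
    by rewrite ler_wpM2l // mulr_ge0 // ltW.
  have E : p * (r - h - r) * r `^ (p - 1) = - (p * h * r `^ (p - 1)) by ring.
  by rewrite E in T2; lra.
have step3 : M / (2 * s) * h * (r - h) `^ p <= M / (2 * s) * h * (2 * K) `^ p.
  apply: ler_wpM2l => //; apply: mulr_ge0; last exact: ltW.
  by apply: divr_ge0 => //; lra.
have kp : 0 <= kappa * p by rewrite mulr_ge0 // ltW.
have := ler_wpM2l kp step2; have := ler_wpM2l kp step3.
by move: step1; rewrite /th; lra.
Qed.

(** * Averages over cells *)

Definition average (R : realType) (a b : R) (f : R -> R) : R :=
  (b - a)^-1 * \int[@lebesgue_measure R]_(s in `[a, b]%classic) f s.

Arguments average {R}.

Lemma integrable_segment (R : realType) (a b : R) (f : R -> R) :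
  continuous f ->
  (@lebesgue_measure R).-integrable `[a, b]%classic (EFin \o f).
Proof.
move=> cf; apply: continuous_compact_integrable; first exact: segment_compact.
exact: continuous_subspaceT.
Qed.

Lemma averageD (R : realType) (a b : R) (f g : R -> R) :
  continuous f -> continuous g ->
  average a b (fun s => f s + g s) = average a b f + average a b g.
Proof.
move=> cf cg; rewrite /average RintegralD ?mulrDr //; exact: integrable_segment.
Qed.

Lemma averageB (R : realType) (a b : R) (f g : R -> R) :
  continuous f -> continuous g ->
  average a b (fun s => f s - g s) = average a b f - average a b g.
Proof.
move=> cf cg; rewrite /average RintegralB ?mulrBr //; exact: integrable_segment.
Qed.

Lemma average_cst (R : realType) (a b c : R) :
  a < b -> average a b (fun=> c) = c.
Proof.
move=> ab; rewrite /average Rintegral_cst //= lebesgue_measure_itv /= lte_fin ab.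
by rewrite /= mulrC mulfK // subr_eq0 gt_eqF.
Qed.

Lemma le_average (R : realType) (a b : R) (f g : R -> R) :
  a < b -> continuous f -> continuous g ->
  (forall s, a <= s <= b -> f s <= g s) -> average a b f <= average a b g.
Proof.
move=> ab cf cg fg; rewrite /average ler_pM2l ?invr_gt0 ?subr_gt0 //.
by apply: le_Rintegral => //; exact: integrable_segment.
Qed.

Lemma row_mx_head (R : realType) (d : nat) (s : R) (v : 'rV[R]_d) :
  (row_mx (s%:M : 'rV[R]_1) v : 'rV_d.+1) 0 ord0 = s.
Proof.
have := row_mxEl (s%:M : 'rV[R]_1) v 0 ord0.
rewrite (_ : @lshift 1 d ord0 = ord0 :> 'I_d.+1); last exact/val_inj.
by move=> ->; rewrite mxE eqxx mulr1n.
Qed.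

Lemma row_mx_behead (R : realType) (d : nat) (s : R) (v : 'rV[R]_d) (j : 'I_d) :
  (row_mx (s%:M : 'rV[R]_1) v : 'rV_d.+1) 0 (lift ord0 j) = v 0 j.
Proof.
have := row_mxEr (s%:M : 'rV[R]_1) v 0 j.
by rewrite (_ : @rshift 1 d j = lift ord0 j :> 'I_d.+1); last exact/val_inj.
Qed.

(** Induction on the dimension: once the first coordinate is fixed, its term joins the constant [c],
    which is why the statement carries one. *)
Lemma box_integral_additive (R : realType) (a b : R) (d : nat)
    (g : 'I_d -> R -> R) (c : R) :
  a < b -> (forall j, continuous (g j)) ->
  box_integral a b (fun s => c + \sum_(j < d) g j (s 0 j)) =
  (b - a) ^+ d * (c + \sum_(j < d) average a b (g j)).
Proof.
move=> ab; elim: d g c => [|d IH] g c cg.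
  by rewrite /= !big_ord0 expr0 mul1r.
have ba0 : b - a != 0 by rewrite subr_eq0 gt_eqF.
have E s : box_integral a b (fun v : 'rV[R]_d =>
    c + \sum_(j < d.+1) g j ((row_mx (s%:M : 'rV[R]_1) v : 'rV_d.+1) 0 j)) =
    (b - a) ^+ d * ((c + \sum_(j < d) average a b (g (lift ord0 j))) + g ord0 s).
  rewrite (_ : (fun v => _) = fun v : 'rV[R]_d =>
      (c + g ord0 s) + \sum_(j < d) g (lift ord0 j) (v 0 j)).
    by rewrite (IH (fun j => g (lift ord0 j))) // addrAC.
  apply/funext => v; rewrite big_ord_recl addrA; congr (_ + _ + _).
    by rewrite row_mx_head.
  by apply: eq_bigr => j _; rewrite row_mx_behead.
rewrite /=; under eq_Rintegral do rewrite E.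
rewrite RintegralZl //; last first.
  apply: integrable_segment => x; apply: cvgD; [exact: cvg_cst|exact: cg].
rewrite exprSr -mulrA; congr (_ * _).
rewrite big_ord_recl; set C := c + \sum_(j < d) _.
have := averageD _ a b (fun=> C) (g ord0) (fun=> cvg_cst _) (cg ord0).
rewrite average_cst // [LHS]/average => H.
by apply: (mulfI (invr_neq0 ba0)); rewrite H mulKf // addrAC -addrA.
Qed.

Lemma shift_continuous (R : realType) (f : R -> R) (x : R) :
  continuous f -> continuous (fun s => f (x + s)).
Proof.
move=> cf u; apply: (@continuous_comp _ _ _ ( +%R x) f); last exact: cf.
by apply: cvgD; [exact: cvg_cst|exact: cvg_id].
Qed.

Definition cell_average (R : realType) (h : R) (f : R -> R) (u : R) : R :=
  average (- (h / 2)) (h / 2) (fun s => f (u + s)).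

Arguments cell_average {R}.

(** Integrating out the other coordinates gives powers of [h] that the prefactor [h ^- d] cancels,
    so averaging keeps the additive form. *)
Lemma Vavg_additive (R : realType) (d : nat) (V : 'rV[R]_d -> R)
    (Vj : 'I_d -> R -> R) (h : R) (x : 'rV[R]_d) :
  0 < h -> (forall x, V x = \sum_(j < d) Vj j (x 0 j)) ->
  (forall j, continuous (Vj j)) ->
  Vavg V h x =
  \sum_(j < d) cell_average h (Vj j) (x 0 j).
Proof.
move=> h0 VE cV; rewrite /Vavg.
have -> : (fun s => V (x + s)) =
    fun s => 0 + \sum_(j < d) (fun u => Vj j (x 0 j + u)) (s 0 j).
  apply/funext => s; rewrite VE add0r; apply: eq_bigr => j _; by rewrite mxE.
rewrite (box_integral_additive _ _ _ _ (fun j u => Vj j (x 0 j + u))).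
- rewrite add0r (_ : h / 2 - - (h / 2) = h); last by field.
  by rewrite mulrA mulVf ?mul1r // expf_neq0 // gt_eqF.
- lra.
- by move=> j; exact: shift_continuous.
Qed.

Lemma sub_continuous (R : realType) (f g : R -> R) :
  continuous f -> continuous g -> continuous (fun s => f s - g s).
Proof. by move=> cf cg s; apply: cvgB; [exact: cf|exact: cg]. Qed.

Lemma is_derive_shift_l (R : realType) (f df : R -> R) (c u : R) :
  is_derive (c + u) 1 f (df (c + u)) -> is_derive u 1 (fun s => f (c + s)) (df (c + u)).
Proof.
move=> H; rewrite -[X in is_derive _ _ _ X]mulr1.
apply: (@is_derive1_comp _ f ( +%R c)).
rewrite -[X in is_derive _ _ _ X]add0r.
exact: (is_deriveD (is_derive_cst c u 1) (is_derive_id u 1)).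
Qed.

Lemma is_derive_continuous (R : realType) (f df : R -> R) :
  (forall u : R, is_derive u 1 f (df u)) -> continuous f.
Proof.
by move=> fdf u; apply/differentiable_continuous/derivable1_diffP; case: (fdf u).
Qed.

(** Mean value theorem on [[0, h]] for [u |-> f (x + u) - f (y + u)], whose derivative compares [df]
    at two points of constant distance [x - y]. *)
Lemma increment_monotone (R : realType) (f df : R -> R) (K kappa h x y : R) :
  (forall u : R, is_derive u 1 f (df u)) -> 0 < h ->
  (forall u w, - K <= w -> w <= u -> u <= K -> kappa * (u - w) <= df u - df w) ->
  - K <= y -> y <= x -> x + h <= K ->
  kappa * h * (x - y) <= (f (x + h) - f x) - (f (y + h) - f y).
Proof.
move=> fdf h0 mono Ky yx xK.
pose g u := f (x + u) - f (y + u).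
pose dg u := df (x + u) - df (y + u).
have dgE (u : R) : is_derive u 1 g (dg u).
  by apply: is_deriveB; apply: is_derive_shift_l.
have [|c /itvP cc] := @MVT_segment R g dg 0 h (ltW h0) (fun u _ => dgE u).
  exact/continuous_subspaceT/(is_derive_continuous _ _ _ dgE).
rewrite /g /dg !addr0 subr0.
have : kappa * (x + c - (y + c)) <= df (x + c) - df (y + c).
  have c0 : 0 <= c by rewrite cc.
  have ch : c <= h by rewrite cc.
  by apply: mono; lra.
by move=> /(ler_wpM2r (ltW h0)); lra.
Qed.

Lemma increment_bound (R : realType) (f df : R -> R) (K M h x : R) :
  (forall u : R, is_derive u 1 f (df u)) -> 0 < h ->
  (forall u, - K <= u <= K -> `|df u| <= M) ->
  - K <= x -> x + h <= K ->
  `|f (x + h) - f x| <= M * h.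
Proof.
move=> fdf h0 bd Kx xK.
have [|c /itvP cc ->] := @MVT_segment R f df x (x + h) ltac:(lra) (fun u _ => fdf u).
  exact/continuous_subspaceT/(is_derive_continuous _ _ _ fdf).
rewrite addrAC subrr add0r normrM (gtr0_norm h0) ler_pM2r //.
by apply: bd; rewrite (le_trans Kx) ?cc // (le_trans _ xK) // cc.
Qed.

(** The bound for increments holds at every shift [s] and is averaged. The margins [h / 2] keep all
    shifted points in [[-K, K]]. *)
Lemma average_increment_monotone (R : realType) (f df : R -> R) (K kappa h x y : R) :
  (forall u : R, is_derive u 1 f (df u)) -> 0 < h ->
  (forall u w, - K <= w -> w <= u -> u <= K -> kappa * (u - w) <= df u - df w) ->
  - K <= y - h / 2 -> y <= x -> x + h + h / 2 <= K ->
  kappa * h * (x - y) <=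
  (cell_average h f (x + h) - cell_average h f x)
  - (cell_average h f (y + h) - cell_average h f y).
Proof.
move=> fdf h0 mono Ky yx xK.
have cf := is_derive_continuous _ _ _ fdf.
have cA u : continuous (fun s => f (u + s)) by exact: shift_continuous.
have hh : - (h / 2) < h / 2 by lra.
rewrite /cell_average -!averageB //; try by [exact: cA|apply: sub_continuous].
rewrite -[leLHS](average_cst _ _ _ _ hh).
apply: le_average => //; first by move=> ?; exact: cvg_cst.
  by do 2 apply: sub_continuous.
move=> s /andP[s1 s2]; rewrite ![_ + h + s]addrAC.
have -> : x - y = (x + s) - (y + s) by ring.
by apply: increment_monotone fdf _ mono _ _ _; lra.
Qed.

Lemma average_increment_bound (R : realType) (f df : R -> R) (K M h x : R) :
  (forall u : R, is_derive u 1 f (df u)) -> 0 < h ->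
  (forall u, - K <= u <= K -> `|df u| <= M) ->
  - K <= x - h / 2 -> x + h + h / 2 <= K ->
  `|cell_average h f (x + h) - cell_average h f x| <= M * h.
Proof.
move=> fdf h0 bd Kx xK.
have cf := is_derive_continuous _ _ _ fdf.
have cA u : continuous (fun s => f (u + s)) by exact: shift_continuous.
have hh : - (h / 2) < h / 2 by lra.
rewrite /cell_average -!averageB //.
have bnd s : - (h / 2) <= s <= h / 2 -> `|f (x + h + s) - f (x + s)| <= M * h.
  move=> /andP[s1 s2]; rewrite [_ + h + s]addrAC.
  by apply: increment_bound fdf _ bd _ _; lra.
rewrite ler_norml; apply/andP; split.
- rewrite -[leLHS](average_cst _ _ _ _ hh).
  apply: le_average => //; [by move=> ?; exact: cvg_cst|exact: sub_continuous|].
  by move=> s /bnd; rewrite ler_norml => /andP[].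
- rewrite -[leRHS](average_cst _ _ _ _ hh).
  apply: le_average => //; [exact: sub_continuous|by move=> ?; exact: cvg_cst|].
  by move=> s /bnd; rewrite ler_norml => /andP[].
Qed.

(** * Rates in coordinates *)

(** The [Vj] are arbitrary functions summing to [V]. On the [j]-th axis through the origin [V]
    equals [Vj j] plus a constant, so the derivative of [Vj j] is read off there; this axis meets
    the cube in the whole segment [[-K, K]]. *)
Definition axis_derivative (R : realType) (d : nat) (V : 'rV[R]_d -> R)
  (j : 'I_d) (u : R) : R := partial j V (u *: evec R j).

Arguments axis_derivative {R d}.

Lemma is_derive_component (R : realType) (d : nat) (V : 'rV[R]_d -> R)
    (Vj : 'I_d -> R -> R) j (u : R) :
  class_C2 V -> (forall x, V x = \sum_(j < d) Vj j (x 0 j)) ->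
  is_derive u 1 (Vj j) (axis_derivative V j u).
Proof.
move=> [_ C1 _] VE.
have [dV _] := C1 j; have {dV} := dV (u *: evec R j).
rewrite /axis_derivative /partial /derivable /derive.
have lineE t : V (t *: evec R j) = Vj j t + \sum_(k < d | k != j) Vj k 0.
  rewrite VE (bigD1 j) //= !mxE !eqxx mulr1; congr (_ + _).
  by apply: eq_bigr => k /negPf kj; rewrite !mxE kj andbF mulr0.
rewrite (_ : (fun h : R => _) =
    fun h : R => h^-1 *: ((Vj j \o shift u) (h *: 1) - Vj j u)).
  by move=> H; apply: DeriveDef.
apply/funext => h /=; rewrite -scalerDl !lineE; congr (_ *: _).
by rewrite /GRing.scale /= mulr1; ring.
Qed.

Lemma axis_derivative_continuous (R : realType) (d : nat) (V : 'rV[R]_d -> R) j :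
  class_C2 V -> continuous (axis_derivative V j).
Proof.
move=> [_ C1 _] u; have [_ cV] := C1 j.
apply: (@continuous_comp _ _ _ (fun u : R => u *: evec R j) (partial j V)).
  exact: scalel_continuous.
exact: cV.
Qed.

Lemma axis_derivative_bounded (R : realType) (d : nat) (V : 'rV[R]_d -> R) (K : R) :
  0 < K -> class_C2 V ->
  exists2 M : R, 0 < M & forall j (u : R), - K <= u <= K -> `|axis_derivative V j u| <= M.
Proof.
move=> K0 C2.
have /choice[m mP] : forall j, exists m : R,
    forall u, - K <= u <= K -> `|axis_derivative V j u| <= m.
  move=> j.
  have [||c _ cP] := @EVT_max R (fun u => `|axis_derivative V j u|) (- K) K.
  - lra.
  - apply: continuous_subspaceT => u; apply: cvg_norm.
    exact: axis_derivative_continuous.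
  - by exists `|axis_derivative V j c| => u uK; apply: cP; rewrite in_itv.
(* The sum makes the bound uniform in [j], the [1] makes it positive. *)
exists (1 + \sum_j `|m j|).
  by rewrite ltr_wpDr // sumr_ge0.
move=> j u uK; apply: le_trans (mP j u uK) _; rewrite (le_trans (ler_norm _)) //.
by rewrite (bigD1 j) //= addrCA lerDl addr_ge0 // sumr_ge0.
Qed.

(** Testing the gradient at two points of the [j]-th axis leaves one term of the scalar product,
    from which a factor [u - w] is divided out. *)
Lemma axis_derivative_monotone (R : realType) (d : nat) (V : 'rV[R]_d -> R)
    (K kappa : R) j (u w : R) :
  strongly_monotone_gradient K kappa V -> 0 < K ->
  - K <= w -> w <= u -> u <= K ->
  kappa * (u - w) <= axis_derivative V j u - axis_derivative V j w.
Proof.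
move=> mono K0 Kw wu uK.
have [->|wu'] := eqVneq w u; first by rewrite !subrr mulr0.
have cubeP t : - K <= t -> t <= K -> cube K (t *: evec R j).
  move=> t1 t2 k; rewrite !mxE /=; case: eqP => _ /=.
    by rewrite mulr1 t1 t2.
  by rewrite mulr0; apply/andP; split; lra.
have := mono _ _ (cubeP u ltac:(lra) uK) (cubeP w Kw ltac:(lra)).
have dotE (g : 'rV[R]_d) : dot (u *: evec R j - w *: evec R j) g = (u - w) * g 0 j.
  rewrite -scalerBl /dot (bigD1 j) //= !mxE !eqxx mulr1 big1 ?addr0 // => k /negPf kj.
  by rewrite !mxE kj andbF mulr0 mul0r.
have vj : (u *: evec R j - w *: evec R j) 0 j = u - w.
  by rewrite !mxE !eqxx !mulr1.
rewrite /enorm !dotE vj sqr_sqrtr -?expr2 ?sqr_ge0 // !mxE expr2 mulrCA.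
by rewrite ler_pM2l // subr_gt0 lt_neqAle wu' wu.
Qed.

Definition gcoord (R : realType) (K h : R) (n : nat) : R :=
  - K + h * n.+1%:R - h / 2.

Definition move_ok (N : nat) (b : bool) (n : nat) : bool :=
  if b then (n.+1 < N)%N else (0 < n)%N.

(** Total on [nat]: where [move_ok] fails, it stays at 0 or leaves the grid at the top, but the rate
    there is 0. *)
Definition move_nat (b : bool) (n : nat) : nat := if b then n.+1 else n.-1.

Arguments gcoord {R}.

Lemma gpointE (R : realType) (d N : nat) (K h : R) (i : grid d N) j :
  gpoint K h i 0 j = gcoord K h (i j).
Proof. by rewrite mxE. Qed.

Lemma gcoordB (R : realType) (K h : R) n m :
  gcoord K h n - gcoord K h m = h * (n%:R - m%:R).
Proof. by rewrite /gcoord -!natr1; ring. Qed.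

Lemma gpoint_stepE (R : realType) (d N : nat) (K h : R) (i : grid d N)
    (j j' : 'I_d) (b : bool) :
  (gpoint K h i + step h (j, b)) 0 j' =
  gcoord K h (i j') + (if j' == j then if b then h else - h else 0).
Proof.
rewrite [LHS]mxE gpointE; congr (_ + _).
by rewrite !mxE /=; case: eqP => _; rewrite ?mulr1 ?mulr0.
Qed.

(** Dividing each coordinate equation by [h] leaves an equation between naturals; this is what
    decides the choice made in [target]. *)
Lemma gpoint_step (R : realType) (d N : nat) (K h : R) (i k : grid d N)
    (j : 'I_d) (b : bool) : 0 < h ->
  (gpoint K h k == gpoint K h i + step h (j, b)) =
  move_ok N b (i j) &&
  [forall j', (k j' : nat) == if j' == j then move_nat b (i j) else i j'].
Proof.
move=> h0.
have E j' : (gpoint K h k 0 j' = (gpoint K h i + step h (j, b)) 0 j') <->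
    (k j')%:R = (i j')%:R + (if j' == j then if b then 1 else - 1 else 0) :> R.
  rewrite gpointE gpoint_stepE; split => H.
    apply: (mulfI (lt0r_neq0 h0)); move: H; clear; rewrite /gcoord -!natr1.
    by case: eqP => _; case: b => ?; lra.
  by rewrite /gcoord -!natr1 H; clear; case: eqP => _; case: b; lra.
apply/eqP/andP => [/rowP kE|[ok /forallP kE]].
  have {}kE j' := (E j').1 (kE j').
  have := kE j; rewrite eqxx => kj.
  have {}kj : move_ok N b (i j) /\ (k j = move_nat b (i j) :> nat).
    case: b kj {kE E} => /= kj.
      have : (k j = (i j).+1 :> nat).
        by apply/eqP; rewrite -(eqr_nat R) -natr1 kj.
      by move=> <-; split.
    have : (i j = (k j).+1 :> nat).
      by apply/eqP; rewrite -(eqr_nat R) -natr1 kj addrNK.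
    by move=> ->; split.
  split; first exact: kj.1.
  apply/forallP => j'; case: (eqVneq j' j) => [->|j'j]; first by rewrite kj.2.
  by have := kE j'; rewrite (negPf j'j) addr0 => /eqP; rewrite eqr_nat.
apply/rowP => j'; apply: (E j').2; rewrite (eqP (kE j')).
case: (eqVneq j' j) => [->|_]; last by rewrite addr0.
case: b ok {kE E} => /= [_|]; first by rewrite natr1.
by case: (i j : nat) => // n _ /=; rewrite -natr1 addrK.
Qed.

Lemma target_ok (R : realType) (d N : nat) (K h : R) (i : grid d N)
    (j : 'I_d) (b : bool) : 0 < h -> move_ok N b (i j) ->
  exists k, target K h i (j, b) = Some k /\
    forall j', k j' = (if j' == j then move_nat b (i j) else i j') :> nat.
Proof.
move=> h0 ok; rewrite /target; case: pickP => [k|H].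
  rewrite gpoint_step // ok /= => /forallP kE; exists k; split=> // j'.
  exact/eqP/kE.
have lt : (move_nat b (i j) < N)%N.
  case: b ok {H} => //= _; apply: leq_ltn_trans (ltn_ord (i j)); exact: leq_pred.
have := H [ffun j' => if j' == j then Ordinal lt else i j'].
rewrite gpoint_step // ok /= => /negP[]; apply/forallP => j'.
by rewrite ffunE; case: (j' == j).
Qed.

Lemma target_nok (R : realType) (d N : nat) (K h : R) (i : grid d N)
    (j : 'I_d) (b : bool) : 0 < h -> ~~ move_ok N b (i j) ->
  target K h i (j, b) = None.
Proof.
move=> h0 /negPf nok; rewrite /target; case: pickP => [k|//].
by rewrite gpoint_step // nok.
Qed.

Definition axis_rate (R : realType) (s h : R) (N : nat) (U : nat -> R)
  (b : bool) : nat -> R := if b then up_rate s h N U else down_rate s h U.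

Definition axis_potential (R : realType) (d : nat) (Vj : 'I_d -> R -> R)
  (K h : R) (j : 'I_d) (n : nat) : R := cell_average h (Vj j) (gcoord K h n).

Arguments axis_rate {R}.
Arguments axis_potential {R d}.

Lemma axis_rate_nok (R : realType) (s h : R) (N : nat) (U : nat -> R) b n :
  ~~ move_ok N b n -> axis_rate s h N U b n = 0.
Proof. by case: b => /negPf /= nok; rewrite /axis_rate /up_rate /down_rate nok. Qed.

Lemma axis_rate_ge0 (R : realType) (s h : R) (N : nat) (U : nat -> R) b n :
  0 < s -> 0 < h -> 0 <= axis_rate s h N U b n.
Proof.
move=> s0 h0; have sh : 0 <= s / h ^+ 2 by rewrite divr_ge0 ?ltW // exprn_gt0.
by case: b; rewrite /= /up_rate /down_rate; case: ifP => // _;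
  rewrite mulr_ge0 // expR_ge0.
Qed.

(** Neighbours differ in one coordinate, so all other terms of the averaged potential cancel. *)
Lemma rateE (R : realType) (d N : nat) (V : 'rV[R]_d -> R)
    (Vj : 'I_d -> R -> R) (sigma K h : R) (i : grid d N) j b :
  0 < h -> (forall x, V x = \sum_(j < d) Vj j (x 0 j)) ->
  (forall j, continuous (Vj j)) ->
  rate V sigma K h i (j, b) =
  axis_rate (sigma ^+ 2) h N (axis_potential Vj K h j) b (i j).
Proof.
move=> h0 VE cV; rewrite /rate.
have [ok|nok] := boolP (move_ok N b (i j)); last first.
  by rewrite target_nok // axis_rate_nok.
have [k [-> kE]] := target_ok _ _ _ K _ i j b h0 ok.
rewrite !(Vavg_additive _ _ _ Vj) // (bigD1 j) // [X in _ - X](bigD1 j) //=.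
rewrite [X in _ + X - _](eq_bigr (fun j => cell_average h (Vj j) (gpoint K h i 0 j))); last first.
  by move=> j' /negPf j'j; rewrite !gpointE kE j'j.
have D (x y z : R) : x + z - (y + z) = x - y by ring.
rewrite D !gpointE kE eqxx.
by case: b ok {kE} => /= ok; rewrite /up_rate /down_rate ok.
Qed.

(** * Drift of the transport cost *)

Definition axis_cost (R : realType) (p K h : R) (n m : nat) : R :=
  `|gcoord K h n - gcoord K h m| `^ p.

Arguments axis_cost {R}.

Definition cost (R : realType) (d N : nat) (p K h : R) (z : grid d N * grid d N)
  : R := \sum_j axis_cost p K h (z.1 j) (z.2 j).

Arguments cost {R d N}.

Definition move_target (R : realType) (d N : nat) (K h : R) (i : grid d N)
  (g : moves d) : grid d N := odflt i (target K h i g).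

Arguments move_target {R d N}.

(** Only solo moves occur: a joint move shifts both indices alike and keeps their difference. *)
Definition axis_drift (R : realType) (p K h : R) (r : bool -> nat -> R)
    (n m : nat) : R :=
  \sum_b ((r b n - Num.min (r b n) (r b m)) *
            (axis_cost p K h (move_nat b n) m - axis_cost p K h n m)
        + (r b m - Num.min (r b n) (r b m)) *
            (axis_cost p K h n (move_nat b m) - axis_cost p K h n m)).

Arguments axis_drift {R}.

Lemma axis_costC (R : realType) (p K h : R) n m :
  axis_cost p K h n m = axis_cost p K h m n.
Proof. by rewrite /axis_cost distrC. Qed.

Lemma axis_driftC (R : realType) (p K h : R) r n m :
  axis_drift p K h r n m = axis_drift p K h r m n.
Proof.
apply: eq_bigr => b _; rewrite (minC (r b n)) addrC.
rewrite (axis_costC _ _ _ _ (move_nat b m) n) (axis_costC _ _ _ _ m n).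
by rewrite (axis_costC _ _ _ _ m (move_nat b n)).
Qed.

Lemma axis_cost_both (R : realType) (p K h : R) N b n m :
  move_ok N b n -> move_ok N b m ->
  axis_cost p K h (move_nat b n) (move_nat b m) = axis_cost p K h n m.
Proof.
move=> okn okm; rewrite /axis_cost !gcoordB; congr (`| _ * _ | `^ _).
case: b okn okm => /= [_ _|]; first by rewrite -!natr1; lra.
by case: n => // n; case: m => // m _ _ /=; rewrite -!natr1; lra.
Qed.

Lemma axis_drift_le (R : realType) (s h K kappa M p : R) (N : nat) (U : nat -> R) :
  0 < s -> 0 < h -> 0 < kappa -> h * N%:R = 2 * K -> kappa * K <= M ->
  h * M <= s -> 1 < p ->
  (forall m n, (m <= n)%N -> (n.+1 < N)%N ->
     kappa * h * (h * (n%:R - m%:R)) <= (U n.+1 - U n) - (U m.+1 - U m)) ->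
  (forall n, (n.+1 < N)%N -> `|U n.+1 - U n| <= M * h) ->
  forall m n, (m < N)%N -> (n < N)%N ->
  axis_drift p K h (axis_rate s h N U) n m <=
    - (p * kappa) * axis_cost p K h n m +
    p * kappa * (p * (2 * K) `^ (p - 1) + M / (2 * s) * (2 * K) `^ p) * h.
Proof.
move=> s0 h0 k0 hN kK hM p1 Umono Ubd m n mN nN.
(* The drift and the cost are symmetric in the two copies. *)
wlog : m n mN nN / (m <= n)%N.
  move=> W; have [/W-> //|/ltnW/W] := leqP m n.
  by rewrite axis_driftC axis_costC; apply.
rewrite leq_eqVlt => /predU1P[->|mn].
  rewrite /axis_drift big1; last first.
    by move=> b _; rewrite minxx subrr !mul0r addr0.
  have p0 : p != 0 by rewrite gt_eqF //; lra.
  have K0 : 0 <= K.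
    by have : 0 <= h * N%:R by [rewrite mulr_ge0 // ltW]; rewrite hN; lra.
  have M0 : 0 <= M by apply: le_trans kK; exact: mulr_ge0 (ltW k0) K0.
  rewrite /axis_cost subrr normr0 powR0 // mulr0 add0r.
  have Ms0 : 0 <= M / (2 * s) by apply: divr_ge0 => //; lra.
  have pk0 : 0 <= p * kappa by apply: mulr_ge0 (ltW k0); lra.
  apply: mulr_ge0 (ltW h0); apply: mulr_ge0 pk0 _.
  by apply: addr_ge0; apply: mulr_ge0 (powR_ge0 _ _); lra.
have mnN : (m < n < N)%N by rewrite mn.
have [upm dnm H] := @rates_contract R s h K kappa M p N U
  s0 h0 k0 hN kK hM p1 Umono Ubd m n mnN.
have nm1 : 1 <= n%:R - m%:R :> R by rewrite lerBrDr nat1r ler_nat.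
(* Of the four solo terms two vanish; the lower copy going up and the upper copy going down
   remain. *)
rewrite /axis_drift big_bool /= (min_l upm) (min_r dnm) !subrr !mul0r addr0 add0r.
have costE k l : (l <= k)%N -> axis_cost p K h k l = (h * (k%:R - l%:R)) `^ p.
  move=> lk; rewrite /axis_cost gcoordB ger0_norm // mulr_ge0 ?(ltW h0) //.
  by rewrite subr_ge0 ler_nat.
rewrite !costE ?(ltnW mn) //; last by lia.
have -> : h * (n%:R - m.+1%:R) = h * (n%:R - m%:R) - h by rewrite -natr1; ring.
have -> : h * (n.-1%:R - m%:R) = h * (n%:R - m%:R) - h.
  by case: n mn {nN mnN upm dnm nm1 H} => // n _ /=; rewrite -natr1; ring.
by apply: le_trans _ H; rewrite -mulrDl.
Qed.

(** A move along axis [j] changes only the [j]-th summand of the cost, so the generator splits into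
    one drift per axis. *)
Lemma mxop_cost (R : realType) (d N : nat) (p K h s : R)
    (c : grid d N -> moves d -> R) (U : 'I_d -> nat -> R) x y :
  0 < s -> 0 < h ->
  (forall i j b, c i (j, b) = axis_rate s h N (U j) b (i j)) ->
  mxop (coupledmx c (move_target K h)) (cost p K h) (x, y) =
  \sum_j axis_drift p K h (axis_rate s h N (U j)) (x j) (y j).
Proof.
move=> s0 h0 cE; rewrite mxop_coupledmx sum_pairE.
apply: eq_bigr => j _; apply: eq_bigr => b _; rewrite !cE.
set r := axis_rate s h N (U j).
have r0 n : 0 <= r b n by exact: axis_rate_ge0.
have diffE (x' y' : grid d N) :
    (forall k, k != j -> x' k = x k /\ y' k = y k) ->
    cost p K h (x', y') - cost p K h (x, y) =
    axis_cost p K h (x' j) (y' j) - axis_cost p K h (x j) (y j).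
  move=> H; rewrite /cost /= (bigD1 j) //= [X in _ - X](bigD1 j) //=.
  rewrite [X in _ + X - _](eq_bigr (fun k => axis_cost p K h (x k) (y k))).
    by ring.
  by move=> k /H[-> ->].
have targetE (i : grid d N) : move_ok N b (i j) ->
    move_target K h i (j, b) j = move_nat b (i j) :> nat /\
    forall k, k != j -> move_target K h i (j, b) k = i k.
  move=> /(target_ok _ _ _ K _ i j b h0)[k [E kE]]; rewrite /move_target E /=.
  split; first by rewrite kE eqxx.
  by move=> l /negPf lj; apply/val_inj; rewrite /= kE lj.
have nok i : ~~ move_ok N b i -> r b i = 0 by exact: axis_rate_nok.
have [okx|nokx] := boolP (move_ok N b (x j));
  have [oky|noky] := boolP (move_ok N b (y j)).
- have [xj xk] := targetE x okx; have [yj yk] := targetE y oky.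
  rewrite !diffE.
  + by rewrite xj yj (axis_cost_both _ _ _ _ N) // subrr mulr0 add0r.
  + by move=> k kj; rewrite yk.
  + by move=> k kj; rewrite xk.
  + by move=> k kj; rewrite xk ?yk.
(* If one copy is blocked its rate is 0, hence so is the joint rate, and the other copy moves alone
   at its full rate. *)
- have [xj xk] := targetE x okx.
  rewrite (nok _ noky) min_r // !mul0r !subr0 !mul0r add0r !addr0.
  rewrite diffE ?xj //.
  by move=> k kj; rewrite xk.
- have [yj yk] := targetE y oky.
  rewrite (nok _ nokx) min_l // !mul0r !subr0 !mul0r !add0r.
  rewrite diffE ?yj //.
  by move=> k kj; rewrite yk.
- by rewrite (nok _ nokx) (nok _ noky) minxx subr0 !mul0r !addr0.
Qed.

(** * Contraction in Wasserstein distance *)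

Lemma lawE (R : realType) (d N : nat) (V : 'rV[R]_d -> R) (sigma K h t : R)
    (nu : grid d N -> R) :
  law V sigma K h t nu = flow (jumpmx (rate V sigma K h) (move_target K h)) t nu.
Proof.
apply/funext => k; apply: eq_bigr => i _; rewrite /transition /semigroup.
rewrite (_ : generator V sigma K h = mxop (jumpmx (rate V sigma K h) (move_target K h))) //.
by apply/funext => f; apply/funext => l; rewrite mxop_jumpmx.
Qed.

Lemma axis_cost_le (R : realType) (p K h : R) (N n m : nat) :
  0 < h -> 0 <= p -> h * N%:R = 2 * K -> (n < N)%N -> (m < N)%N ->
  axis_cost p K h n m <= (2 * K) `^ p.
Proof.
move=> h0 p0 hN nN mN; rewrite /axis_cost gcoordB.
apply: ge0_ler_powR => //; rewrite ?nnegrE //.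
  by rewrite -hN mulr_ge0 // ltW.
rewrite -hN normrM (gtr0_norm h0) ler_pM2l // ler_norml.
have nN' : n%:R <= N%:R :> R by rewrite ler_nat ltnW.
have mN' : m%:R <= N%:R :> R by rewrite ler_nat ltnW.
have n0 : 0 <= n%:R :> R by [].
have m0 : 0 <= m%:R :> R by [].
by apply/andP; split; lra.
Qed.

Lemma contracting_coupling (R : realType) (d : nat) (K sigma p : R)
    (V : 'rV[R]_d -> R) (Vj : 'I_d -> R -> R) :
  (0 < d)%N -> 0 < K -> 0 < sigma -> 1 < p -> class_C2 V ->
  (forall x, V x = \sum_(j < d) Vj j (x 0 j)) ->
  exists2 C : R, 0 <= C &
    forall kappa : R, 0 < kappa -> strongly_monotone_gradient K kappa V ->
    forall (h : R) (N : nat), 0 < h -> 2 * K / h = N%:R ->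
    forall (nu eta : grid d N -> R) g, couplings nu eta g ->
    forall t : R, 0 <= t ->
    exists2 G, couplings (law V sigma K h t nu) (law V sigma K h t eta) G &
      \sum_z cost p K h z * G z <=
      expR (- (p * kappa) * t) * (\sum_z cost p K h z * g z) + C * h.
Proof.
move=> d0 K0 sigma0 p1 C2 VE.
have [M M0 Mbd] := axis_derivative_bounded _ _ _ _ K0 C2.
have dV j (u : R) : is_derive u 1 (Vj j) (axis_derivative V j u).
  exact: is_derive_component C2 VE.
have cV j : continuous (Vj j) by exact: is_derive_continuous (dV j).
pose s := sigma ^+ 2; have s0 : 0 < s by exact: exprn_gt0.
pose D := p * (2 * K) `^ (p - 1) + M / (2 * s) * (2 * K) `^ p.
have p0 : 0 < p by lra.
have D0 : 0 <= D.
  apply: addr_ge0; apply: mulr_ge0 (powR_ge0 _ _); first lra.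
  by apply: divr_ge0; lra.
have E0 : 0 <= d%:R * (2 * K) `^ p * M / s.
  by rewrite divr_ge0 ?(ltW s0) // mulr_ge0 ?(ltW M0) // mulr_ge0 ?powR_ge0.
(* The first term is the Gronwall error for small [h]. The second covers [h * M > s], where the
   largest possible cost [d (2 K)^p] is at most [d (2 K)^p (h M / s)]. *)
exists (d%:R * D + d%:R * (2 * K) `^ p * M / s).
  by rewrite addr_ge0 // mulr_ge0.
move=> kappa k0 mono h N h0 hN nu eta g gP t t0.
have {}hN : h * N%:R = 2 * K by rewrite -hN mulrC divfK // gt_eqF.
pose c : grid d N -> moves d -> R := rate V sigma K h.
have cE i j b : c i (j, b) = axis_rate s h N (axis_potential Vj K h j) b (i j).
  exact: rateE.
have c0 i m : 0 <= c i m by case: m => j b; rewrite cE axis_rate_ge0.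
exists (flow (coupledmx c (move_target K h)) t g).
  by rewrite !lawE; exact: flow_coupling.
have [g0 g1] : is_prob g by case: gP.
have expg0 : 0 <= expR (- (p * kappa) * t) * (\sum_z cost p K h z * g z).
  apply: mulr_ge0 (expR_ge0 _) _; apply: sumr_ge0 => z _; apply: mulr_ge0 => //.
  by apply: sumr_ge0 => j _; exact: powR_ge0.
have [hM|hM] := leP (h * M) s; last first.
  have [[G0 G1] _ _] : couplings (flow (jumpmx c (move_target K h)) t nu)
    (flow (jumpmx c (move_target K h)) t eta) (flow (coupledmx c (move_target K h)) t g).
    exact: flow_coupling.
  apply: (@le_trans _ _ (d%:R * (2 * K) `^ p)).
    rewrite -[leRHS]mulr1 -[X in _ <= _ * X]G1 mulr_sumr; apply: ler_sum => z _.
    apply: ler_wpM2r => //.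
    apply: (@le_trans _ _ (\sum_(j < d) (2 * K) `^ p)).
      by apply: ler_sum => j _; apply: (axis_cost_le _ _ _ _ N) => //; exact: ltW.
    by rewrite sumr_const card_ord [leRHS]mulr_natl.
  apply: (@le_trans _ _ (d%:R * (2 * K) `^ p * M / s * h)).
    have -> : d%:R * (2 * K) `^ p * M / s * h =
      d%:R * (2 * K) `^ p * ((h * M) / s) by ring.
    rewrite ler_peMr ?mulr_ge0 ?powR_ge0 //.
    by rewrite ler_pdivlMr // mul1r ltW.
  have Dh0 : 0 <= d%:R * D * h by rewrite mulr_ge0 ?(ltW h0) // mulr_ge0.
  by rewrite [(_ + _) * h]mulrDl addrA lerDr addr_ge0.
(* Monotonicity between the end points [-K] and [K] gives [2 kappa K], while two values bounded by
   [M] differ by at most [2 M]. *)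
have kK : kappa * K <= M.
  have := axis_derivative_monotone _ _ _ _ _ (Ordinal d0) K (- K) mono K0.
  move=> /(_ ltac:(lra) ltac:(lra) ltac:(lra)).
  have := Mbd (Ordinal d0) K ltac:(lra).
  have := Mbd (Ordinal d0) (- K) ltac:(lra).
  by rewrite !ler_norml => /andP[? ?] /andP[? ?]; lra.
pose U j := axis_potential Vj K h j.
(* The cell of index [n.+1] ends at [-K + h (n + 2)], which is at most [K] since [n + 2 <= N];
   likewise cell [n] begins at [-K + h n]. *)
have cell n : (n.+1 < N)%N -> gcoord K h n + h + h / 2 <= K.
  move=> nN; have : n.+2%:R <= N%:R :> R by rewrite ler_nat.
  by rewrite -(ler_pM2l h0) hN /gcoord -!natr1; lra.
have cell0 n : - K <= gcoord K h n - h / 2.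
  have : 0 <= h * n%:R by rewrite mulr_ge0 // ltW.
  by rewrite /gcoord -natr1; lra.
have gS n : gcoord K h n.+1 = gcoord K h n + h.
  by rewrite /gcoord -[n.+2%:R]natr1; ring.
have Umono j m n : (m <= n)%N -> (n.+1 < N)%N ->
    kappa * h * (h * (n%:R - m%:R)) <= (U j n.+1 - U j n) - (U j m.+1 - U j m).
  move=> mn nN; rewrite -(gcoordB _ K) /U /axis_potential !gS.
  apply: average_increment_monotone (dV j) (h0) _ (cell0 m) _ (cell n nN).
    by move=> u w Kw wu uK; exact: axis_derivative_monotone mono K0 Kw wu uK.
  by rewrite -subr_ge0 gcoordB; apply: mulr_ge0 (ltW h0) _; rewrite subr_ge0 ler_nat.
have Ubd j n : (n.+1 < N)%N -> `|U j n.+1 - U j n| <= M * h.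
  move=> nN; rewrite /U /axis_potential !gS.
  exact: average_increment_bound (dV j) h0 (Mbd j) (cell0 n) (cell n nN).
have drift z : mxop (coupledmx c (move_target K h)) (cost p K h) z <=
    - (p * kappa) * cost p K h z + d%:R * (p * kappa * D * h).
  case: z => x y; rewrite (mxop_cost _ _ _ _ _ _ s _ U) //.
  rewrite /cost mulr_sumr.
  have -> : d%:R * (p * kappa * D * h) = \sum_(j < d) (p * kappa * D * h).
    by rewrite sumr_const card_ord mulr_natl.
  rewrite -big_split /=; apply: ler_sum => j _.
  exact: (axis_drift_le _ s h K kappa M p N (U j) s0 h0 k0 hN kK hM p1 (Umono j) (Ubd j)).
have pk0 : 0 < p * kappa by exact: mulr_gt0.
have b0 : 0 <= d%:R * (p * kappa * D * h).
  by rewrite mulr_ge0 // mulr_ge0 ?(ltW h0) // mulr_ge0 // ltW.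
have cc0 := coupled_rate_ge0 _ _ _ _ c0.
apply: le_trans (flow_gronwall _ _ _ _ _ _ _ _ _ _ cc0 t0 pk0 b0 (conj g0 g1) drift) _.
rewrite lerD2l.
(* Here [kappa] cancels, which makes the constant independent of it. *)
have -> : d%:R * (p * kappa * D * h) / (p * kappa) = d%:R * D * h.
  by field; rewrite !gt_eqF.
by rewrite mulrDl lerDl mulr_ge0 // ltW.
Qed.

(** For a ratio [x / c] in [[0, 1]] the exponent [r <= 1] only increases it, so the share [x / c] of
    [c^r] is at most [x^r]. With [c = a + b] the shares of [a] and [b] add up to all of [c^r]. *)
Lemma powR_subadd (R : realType) (a b r : R) :
  0 <= a -> 0 <= b -> 0 < r <= 1 -> (a + b) `^ r <= a `^ r + b `^ r.
Proof.
move=> a0 b0 /andP[r0 r1].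
have share c x : 0 <= x -> x <= c -> 0 < c -> x / c * c `^ r <= x `^ r.
  move=> x0 xc c0; have [->|xn0] := eqVneq x 0.
    by rewrite mul0r mul0r powR_ge0.
  have xc0 : 0 < x / c by rewrite divr_gt0 // lt0r xn0.
  rewrite -{2}(divfK (lt0r_neq0 c0) x) powRM ?(ltW c0) ?(ltW xc0) //.
  rewrite ler_wpM2r ?powR_ge0 // ger1_powR // xc0 /=.
  by rewrite ler_pdivrMr // mul1r.
have [ab0|] := ltP 0 (a + b); last first.
  move=> ab; have -> : a + b = 0 by lra.
  by rewrite powR0 ?gt_eqF // addr_ge0 ?powR_ge0.
have A := share (a + b) a a0 ltac:(lra) ab0.
have B := share (a + b) b b0 ltac:(lra) ab0.
apply: le_trans (lerD A B).
by rewrite -mulrDl -mulrDl divff ?gt_eqF // mul1r.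
Qed.

(** Every initial coupling is evolved and its cost bounded; the infimum is taken afterwards, so no
    optimal coupling is required. The hypothesis on [enorm] identifies the coordinatewise cost with
    the Euclidean one. *)
Lemma wasserstein_contract (R : realType) (d : nat) (K sigma p : R)
    (V : 'rV[R]_d -> R) (Vj : 'I_d -> R -> R) :
  (0 < d)%N -> 0 < K -> 0 < sigma -> 1 < p -> class_C2 V ->
  (forall x, V x = \sum_(j < d) Vj j (x 0 j)) ->
  (forall v : 'rV[R]_d, enorm v `^ p = \sum_j `|v 0 j| `^ p) ->
  exists C : R,
    forall kappa : R, 0 < kappa -> strongly_monotone_gradient K kappa V ->
    forall (h : R) (N : nat), 0 < h -> 2 * K / h = N%:R ->
    forall nu eta : grid d N -> R, is_prob nu -> is_prob eta ->
    forall t : R, 0 <= t ->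
      wasserstein K h p (law V sigma K h t nu) (law V sigma K h t eta)
        <= expR (- kappa * t) * wasserstein K h p nu eta + C * h `^ p^-1.
Proof.
move=> d0 K0 sigma0 p1 C2 VE normE.
have p0 : 0 < p by lra.
have [C C0 CP] := contracting_coupling _ _ _ _ _ _ _ d0 K0 sigma0 p1 C2 VE.
exists (C `^ p^-1) => kappa k0 mono h N h0 hN nu eta nuP etaP t t0.
have costE (g : grid d N * grid d N -> R) :
    \sum_z enorm (gpoint K h z.1 - gpoint K h z.2) `^ p * g z =
    \sum_z cost p K h z * g z.
  apply: eq_bigr => z _; rewrite normE; congr (_ * _); apply: eq_bigr => j _.
  by rewrite /axis_cost /gcoord !mxE.
have cost0 (g : grid d N * grid d N -> R) nu' eta' : couplings nu' eta' g ->
    0 <= \sum_z cost p K h z * g z.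
  move=> [[g0 _] _ _]; apply: sumr_ge0 => z _; apply: mulr_ge0 => //.
  by apply: sumr_ge0 => j _; exact: powR_ge0.
have key g : couplings nu eta g ->
    wasserstein K h p (law V sigma K h t nu) (law V sigma K h t eta) <=
    expR (- kappa * t) * (\sum_z cost p K h z * g z) `^ p^-1 + C `^ p^-1 * h `^ p^-1.
  move=> gP; have [G GP GC] := CP _ k0 mono _ _ h0 hN _ _ _ gP _ t0.
  apply: (@le_trans _ _ ((\sum_z cost p K h z * G z) `^ p^-1)).
    apply: ge_inf; last by exists G => //; rewrite costE.
    by exists 0 => _ [g' _ <-]; exact: powR_ge0.
  have e0 : 0 <= expR (- (p * kappa) * t) * (\sum_z cost p K h z * g z).
    by rewrite mulr_ge0 ?expR_ge0 // (cost0 _ _ _ gP).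
  have Ch0 : 0 <= C * h by rewrite mulr_ge0 // ltW.
  apply: le_trans (ge0_ler_powR _ _ _ GC) _.
  - by rewrite invr_ge0 ltW.
  - by rewrite nnegrE (cost0 _ _ _ GP).
  - by rewrite nnegrE addr_ge0.
  apply: le_trans (powR_subadd _ _ _ _ e0 Ch0 _) _.
    by rewrite invr_gt0 p0 invf_le1 // ltW.
  rewrite (powRM _ (expR_ge0 _) (cost0 _ _ _ gP)) (powRM _ C0 (ltW h0)) lerD2r.
  have <- : expR (- (p * kappa) * t) `^ p^-1 = expR (- kappa * t).
    by rewrite -expRM; congr expR; field; rewrite gt_eqF.
  exact: lexx.
(* The product coupling makes the set of costs nonempty, so that its [inf] is a genuine infimum. *)
have ind : couplings nu eta (fun z => nu z.1 * eta z.2).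
  move: nuP etaP => [nu0 nu1] [eta0 eta1].
  have c1 x : \sum_y nu x * eta y = nu x by rewrite -mulr_sumr eta1 mulr1.
  split => //.
  - split; first by move=> z; exact: mulr_ge0.
    by rewrite sum_pairE; under eq_bigr do rewrite c1.
  - by move=> y; rewrite /= -mulr_suml nu1 mul1r.
(* Isolating the initial distance reduces the claim to a lower bound valid for each coupling. *)
rewrite -lerBlDr -ler_pdivrMl ?expR_gt0 //.
apply: lb_le_inf; first by eexists; exists (fun z => nu z.1 * eta z.2).
move=> _ [g gP <-]; rewrite costE ler_pdivrMl ?expR_gt0 // lerBlDr.
exact: key.
Qed.

Theorem theorem7 (R : realType) (d : nat) (K sigma : R)
  (V : 'rV[R]_d -> R) (Vj : 'I_d -> R -> R)
  (hd : (1 <= d)%N) (hK : 0 < K) (hsigma : 0 < sigma)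
  (hC2 : class_C2 V)
  (hadd : forall x, V x = \sum_(j < d) Vj j (x 0 j))
  (hLip : lipschitz_gradient V) :
  (exists C : R,
     forall kappa : R, 0 < kappa -> strongly_monotone_gradient K kappa V ->
     forall (h : R) (N : nat), 0 < h -> 2 * K / h = N%:R ->
     forall nu eta : grid d N -> R, is_prob nu -> is_prob eta ->
     forall t : R, 0 <= t ->
       wasserstein K h 2 (law V sigma K h t nu) (law V sigma K h t eta)
         <= expR (- kappa * t) * wasserstein K h 2 nu eta + C * h `^ 2^-1)
  /\
  (d = 1%N -> forall p : R, 2 <= p ->
   exists C : R,
     forall kappa : R, 0 < kappa -> strongly_monotone_gradient K kappa V ->
     forall (h : R) (N : nat), 0 < h -> 2 * K / h = N%:R ->
     forall nu eta : grid d N -> R, is_prob nu -> is_prob eta ->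
     forall t : R, 0 <= t ->
       wasserstein K h p (law V sigma K h t nu) (law V sigma K h t eta)
         <= expR (- kappa * t) * wasserstein K h p nu eta + C * h `^ p^-1).
Proof.
split=> [|d1 p p2]; apply: wasserstein_contract hadd _ => //; try lra.
  (* For [p = 2] the square root in [enorm] is undone; for [d = 1] the norm is the absolute value of
     the only coordinate, whatever [p] is. *)
  move=> v; rewrite powR_mulrn ?sqrtr_ge0 // sqr_sqrtr; last first.
    by apply: sumr_ge0 => j _; rewrite -expr2 sqr_ge0.
  by apply: eq_bigr => j _; rewrite powR_mulrn // real_normK ?num_real // expr2.
move=> v; case: d d1 v {V Vj hd hC2 hLip} => [//|[|//]] _ v.
by rewrite /enorm /dot !big_ord1 -expr2 sqrtr_sqr.
Qed.
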